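(* Let $d\geq 1$ be an integer, let $G=(V,E)$ be a $(d+1)$-connected graph and $u,v\in V$. Suppose that $G[V_0]$ is a $(u,v)$-rigid subgraph of $G$ in $\mathbb{R}^d$. If ${\rm Clique}(G,V_0)$ is globally rigid in $\mathbb{R}^d$, then $\{u,v\}$ is weakly globally linked in $G$ in $\mathbb{R}^d$.
   Context: Graphs are finite and simple. A $d$-dimensional framework (or realization of $G$ in $\mathbb{R}^d$) is a pair $(G,p)$, where $G=(V,E)$ is a graph and $p:V\to\mathbb{R}^d$. Frameworks $(G,p)$ and $(G,q)$ are equivalent if $\|p(x)-p(y)\|=\|q(x)-q(y)\|$ for all $xy\in E$, and congruent if this equality holds for all $x,y\in V$. $(G,p)$ is generic if the $d|V|$ coordinates of the points $p(x)$, $x\in V$, are algebraically independent over $\mathbb{Q}$. $(G,p)$ is rigid if there is $\varepsilon>0$ such that every $(G,q)$ equivalent to $(G,p)$ with $\|p(x)-q(x)\|<\varepsilon$ for all $x\in V$ is congruent to $(G,p)$; it is globally rigid if every $d$-dimensional framework equivalent to it is congruent to it. A graph $G$ is rigid (resp. globally rigid) in $\mathbb{R}^d$ if every (equivalently, some) generic realization of $G$ in $\mathbb{R}^d$ is rigid (resp. globally rigid). A pair $\{u,v\}$ of vertices is globally linked in $(G,p)$ if $\|p(u)-p(v)\|=\|q(u)-q(v)\|$ for every $d$-dimensional framework $(G,q)$ equivalent to $(G,p)$. The pair is weakly globally linked in $G$ in $\mathbb{R}^d$ if it is globally linked in some generic $d$-dimensional framework $(G,p)$. For $X\subseteq V$,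 the induced subgraph $G[X]$ is $(u,v)$-rigid in $\mathbb{R}^d$ if $G[X]$ is rigid in $\mathbb{R}^d$ and $u,v\in X$. For $\emptyset\neq X\subseteq V$, let $V_1,\dots,V_r$ be the vertex sets of the connected components of $G-X$. The graph ${\rm Clique}(G,X)$ is obtained from $G$ by deleting the sets $V_1,\dots,V_r$ and adding a new edge $xy$ for all pairs $x,y\in N_G(V_i)$ with $xy\notin E$, for $1\leq i\leq r$, where $N_G(V_i)$ is the set of vertices outside $V_i$ having a neighbour in $V_i$. *)

(* Defs.v *)
From mathcomp Require Import all_boot all_order all_algebra.
From mathcomp Require Import reals.
From mathcomp Require mpoly.

Set Implicit Arguments.
Unset Strict Implicit.
Unset Printing Implicit Defensive.

Import GRing.Theory Num.Theory.
Local Open Scope ring_scope.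

Record sgraph (V : finType) := SGraph {
  edge :> rel V;
  edge_sym : symmetric edge;
  edge_irr : irreflexive edge
}.

Section Graphs.
Variable V : finType.
Implicit Types (G : sgraph V) (X C : {set V}).

Definition graph_connected G : Prop :=
  (0 < #|V|)%N /\ forall x y : V, connect G x y.

Definition components G : {set {set V}} :=
  equivalence_partition (connect G) [set: V].

Definition neighbours G C : {set V} :=
  [set y | (y \notin C) && [exists x in C, G x y]].

Definition induced_edge G X : rel {x | x \in X} :=
  fun x y => G (val x) (val y).

Lemma induced_edge_sym G X : symmetric (@induced_edge G X).
Proof. by move=> x y; apply: edge_sym. Qed.

Lemma induced_edge_irr G X : irreflexive (@induced_edge G X).
Proof. by move=> x; apply: edge_irr. Qed.

Definition induced_subgraph G X : sgraph {x | x \in X} :=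
  SGraph (@induced_edge_sym G X) (@induced_edge_irr G X).

Definition delete_vertices G X : sgraph {x | x \in ~: X} := induced_subgraph G (~: X).

End Graphs.

Definition k_connected (V : finType) (k : nat) (G : sgraph V) : Prop :=
  (k < #|V|)%N /\ forall S : {set V}, (#|S| < k)%N -> graph_connected (delete_vertices G S).

Section Clique.
Variables (V : finType) (G : sgraph V) (X : {set V}).

Definition clique_edge : rel {x | x \in X} := fun x y =>
  G (val x) (val y) ||
  (x != y) && [exists C in components (delete_vertices G X),
    (val x \in neighbours G (val @: C)) && (val y \in neighbours G (val @: C))].

Lemma clique_edge_sym : symmetric clique_edge.
Proof.
move=> x y; rewrite /clique_edge edge_sym eq_sym; congr (_ || _ && _).
by apply: eq_existsb => C; rewrite [X in _ && X]andbC.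
Qed.

Lemma clique_edge_irr : irreflexive clique_edge.
Proof. by move=> x; rewrite /clique_edge edge_irr eqxx. Qed.

Definition Clique : sgraph {x | x \in X} := SGraph clique_edge_sym clique_edge_irr.

End Clique.

Import -(notations) mpoly.

Section Frameworks.
Variables (R : realType) (d : nat).

(* The canonical norm `|_| on 'rV[R]_d is the sup norm, hence this definition. *)
Definition enorm (a : 'rV[R]_d) : R := Num.sqrt (\sum_(i < d) a 0 i ^+ 2).

Definition equivalent (V : finType) (G : sgraph V) (p q : V -> 'rV[R]_d) : Prop :=
  forall x y : V, G x y -> enorm (p x - p y) = enorm (q x - q y).

Definition congruent (V : finType) (p q : V -> 'rV[R]_d) : Prop :=
  forall x y : V, enorm (p x - p y) = enorm (q x - q y).

(* The d|V| coordinates of p as one family indexed by an ordinal, the index type of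
   the variables in mpoly. *)
Definition coordinates (V : finType) (p : V -> 'rV[R]_d)
    (k : 'I_(#|{: V * 'I_d}|)) : R :=
  let xi := enum_val k in p xi.1 0 xi.2.

Definition alg_independent (n : nat) (a : 'I_n -> R) : Prop :=
  forall P : mpoly n rat,
    meval a (map_mpoly (@ratr R) P) = 0 -> P = 0.

Definition generic (V : finType) (p : V -> 'rV[R]_d) : Prop :=
  alg_independent (coordinates p).

Definition rigid_framework (V : finType) (G : sgraph V) (p : V -> 'rV[R]_d) : Prop :=
  exists2 eps : R, 0 < eps & forall q : V -> 'rV[R]_d,
    equivalent G p q -> (forall x : V, enorm (p x - q x) < eps) -> congruent p q.

Definition globally_rigid_framework (V : finType) (G : sgraph V)
    (p : V -> 'rV[R]_d) : Prop :=
  forall q : V -> 'rV[R]_d, equivalent G p q -> congruent p q.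

Definition globally_linked (V : finType) (G : sgraph V) (p : V -> 'rV[R]_d)
    (u v : V) : Prop :=
  forall q : V -> 'rV[R]_d,
    equivalent G p q -> enorm (p u - p v) = enorm (q u - q v).

End Frameworks.

Section GenericProperties.
Variables (R : realType) (d : nat) (V : finType) (G : sgraph V).

Definition rigid : Prop :=
  forall p : V -> 'rV[R]_d, generic p -> rigid_framework G p.

Definition globally_rigid : Prop :=
  forall p : V -> 'rV[R]_d, generic p -> globally_rigid_framework G p.

Definition weakly_globally_linked (u v : V) : Prop :=
  exists2 p : V -> 'rV[R]_d, generic p & globally_linked G p u v.

End GenericProperties.

Definition uv_rigid (R : realType) (d : nat) (V : finType) (G : sgraph V)
    (X : {set V}) (u v : V) : Prop :=
  [/\ rigid R d (induced_subgraph G X), u \in X & v \in X].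

(* Main.v *)
From HB Require Import structures.
Require Import Defs.
From mathcomp Require Import all_boot all_order all_algebra reals.
From mathcomp Require Import boolp classical_sets topology normedtype sequences.
From mathcomp Require Import polyrcf ordered_qelim qe_rcf.
From mathcomp Require mpoly.
From mathcomp Require Import ring lra zify.

(** Write H = G[V0]. Fix a generic placement p of V0 and, for each component C of
G - V0, a point c_C generic over p; then place all the vertices of C very close to
c_C. Such a realization of G looks like a realization of the graph obtained from G
by contracting every component to a single vertex, and the theorem follows from
two facts.

In the contracted framework everything is forced. Let (q, c') be equivalent to
(p, c). The component C has at least d+1 attachments N(C) in V0, because G is
(d+1)-connected, and c_C sees these points at the same distances as c'_C sees
their images. Since c_C is generic over p, and q is algebraic over p up to an
isometry, this can only happen when q is congruent to p on N(C)
(generic_distances_congruent). Hence q is equivalent to p in Clique(G, V0), and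
global rigidity of that graph makes q congruent to p (contracted_congruent).

The limit keeps this. If {u,v} were linked in no generic realization, there would
be generic realizations p_n of G that extend p and send C closer and closer to c_C,
and equivalent realizations q_n in which the distance from u to v is wrong. After a
translation the q_n are bounded, because G is connected, and a subsequence converges
to a realization equivalent to the contracted one (equivalent_limit), so that its
restriction to V0 is congruent to p. Thus up to an isometry q_n comes arbitrarily
close to p on V0, and rigidity of (H, p) makes q_n congruent to p there
(rigid_limit_congruent), a contradiction.

The argument needs that every realization q equivalent to (H, p) is algebraic over
p up to isometry. Algebraic dependence is expressed through derivations of the field
of real numbers: an element is algebraic over a set S exactly when every derivation
that vanishes on S vanishes at it. Derivations form a vector space, so that
transcendence degree becomes linear algebra, and they can be applied to equations
between distances. The existence of enough derivations comes from Zorn's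
lemma (derivation_extends), and a family x is called dual when there are derivations
D_i with D_i x_j = 1 if i = j and 0 otherwise; dual families are algebraically
independent, and every point has dual families arbitrarily close to it.

Rigidity enters through rigidity_constants: for a rigid framework, a derivation that
kills the edge lengths kills all distances. Indeed p is, up to isometry, the only
solution of the edge equations in a small box, and by quantifier elimination over
real closed fields the set of values that a distance takes on such solutions is
described by polynomial conditions over the field generated by the edge lengths.
A transcendental value would be accompanied by a whole interval of values. The
eliminated formulas have real coefficients, and instead of tracing them through the
elimination one adds them to the field of constants: there are finitely many, and p is
chosen generic over them.

Given this, count dimensions (pinned_algebraic). Put q in triangular position, which
leaves d|V0| - d(d+1)/2 coordinates. A derivation that kills these
coordinates kills the common edge lengths, hence moves p by an infinitesimal isometry,
and those form a space of dimension d(d+1)/2. Since p is generic, derivations take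
arbitrary values on its d|V0| coordinates, so no dimension is left for a derivation
that kills p and not q.

If V0 has at most d vertices the contraction argument has no room, but then a
rigid H is complete (small_rigid_complete), so that u and v are adjacent or equal. *)

Set Implicit Arguments.
Unset Strict Implicit.
Unset Printing Implicit Defensive.
Import Order.TTheory GRing.Theory Num.Theory.
Import -(notations) mpoly.
Import numFieldNormedType.Exports.
Local Open Scope ring_scope.

(** * Dual numbers *)

Section DualNumbers.
Variable R : fieldType.

(** The ring R[eps] with eps ^ 2 = 0, the pair (a, b) standing for a + b eps. A
derivation of a subring K of R is the same as a subring of dual numbers that is the
graph of a function on K. *)
Definition dual : Type := (R * R)%type.
HB.instance Definition _ := GRing.Zmodule.on dual.

Definition dual_mul (z w : dual) : dual := (z.1 * w.1, z.1 * w.2 + z.2 * w.1).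

Fact dual_mulA : associative dual_mul.
Proof. by move=> x y z; congr pair; rewrite /=; ring. Qed.
Fact dual_mulC : commutative dual_mul.
Proof. by move=> x y; congr pair; rewrite /=; ring. Qed.
Fact dual_mul1 : left_id ((1, 0) : dual) dual_mul.
Proof. by case=> a b; congr pair; rewrite /=; ring. Qed.
Fact dual_mulD : left_distributive dual_mul +%R.
Proof. by move=> x y z; congr pair; rewrite /=; ring. Qed.
Fact dual_1neq0 : (1, 0) != 0 :> dual.
Proof. by apply/eqP => -[/eqP]; rewrite oner_eq0. Qed.
HB.instance Definition _ := GRing.Zmodule_isComNzRing.Build dual
  dual_mulA dual_mulC dual_mul1 dual_mulD dual_1neq0.

Lemma dualM (z w : dual) : z * w = (z.1 * w.1, z.1 * w.2 + z.2 * w.1).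
Proof. by []. Qed.

Definition re (z : dual) : R := z.1.
Fact re_additive : {morph re : x y / x - y}. Proof. by []. Qed.
HB.instance Definition _ := GRing.isZmodMorphism.Build dual R re re_additive.
Fact re_monoid_morphism : monoid_morphism re. Proof. by []. Qed.
HB.instance Definition _ := GRing.isMonoidMorphism.Build dual R re re_monoid_morphism.

Lemma re_horner (P : {poly dual}) z : re P.[z] = (map_poly re P).[re z].
Proof. by rewrite horner_map. Qed.

Lemma dual_cancel (c z : dual) : re c != 0 -> c * z = 0 -> z = 0.
Proof.
case: c z => c c' [a b]; rewrite /re /= => c0 [/eqP].
rewrite mulf_eq0 (negbTE c0) /= => /eqP -> /eqP.
by rewrite mulr0 addr0 mulf_eq0 (negbTE c0) /= => /eqP ->.
Qed.

(** Taylor expansion to first order at x, since (x, a) = x + a eps. *)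
Lemma horner_shift (P : {poly dual}) (x a : R) :
  P.[(x, a) : dual] = P.[(x, 0) : dual] + (0, (map_poly re P)^`().[x] * a).
Proof.
elim/poly_ind: P => [|P c IH].
  by rewrite rmorph0 deriv0 !horner0 mul0r add0r.
rewrite rmorphD rmorphM /= map_polyX map_polyC /= !derivE !hornerE {}IH.
move: (re_horner P (x, 0)); rewrite /= {2}/re /=.
case: P.[_] => u v /= <-.
rewrite !dualM /=; congr pair; rewrite /re /=; ring.
Qed.

End DualNumbers.

(** * Extension of derivations *)

Section Subrings.
Variables (A : nzRingType) (K : A -> Prop).

(** Subrings are kept as propositional predicates, because the ones needed below
come from classical choices and from kernels of derivations. *)
Definition is_subring := [/\ K 1, forall x y, K x -> K y -> K (x - y)
  & forall x y, K x -> K y -> K (x * y)].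

Hypothesis KR : is_subring.

Lemma subring1 : K 1. Proof. by case: KR. Qed.
Lemma subringB x y : K x -> K y -> K (x - y). Proof. by case: KR => _ + _; apply. Qed.
Lemma subringM x y : K x -> K y -> K (x * y). Proof. by case: KR => _ _; apply. Qed.
Lemma subring0 : K 0. Proof. by rewrite -(subrr 1); apply: subringB; exact: subring1. Qed.
Lemma subringN x : K x -> K (- x).
Proof. by rewrite -sub0r; apply: subringB; exact: subring0. Qed.
Lemma subringD x y : K x -> K y -> K (x + y).
Proof. by move=> Kx /subringN; rewrite -{2}[y]opprK; apply: subringB. Qed.
Lemma subringMn x n : K x -> K (x *+ n).
Proof.
move=> Kx; elim: n => [|n IH]; first by rewrite mulr0n; exact: subring0.
by rewrite mulrS; apply: subringD.
Qed.

Definition coefs_in (P : {poly A}) := forall i, K P`_i.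

Lemma coefs_inC c : K c -> coefs_in c%:P.
Proof. by move=> Kc i; rewrite coefC; case: eqP => // _; exact: subring0. Qed.
Lemma coefs_inX : coefs_in 'X.
Proof. by move=> i; rewrite coefX; case: eqP => _; [exact: subring1 | exact: subring0]. Qed.
Lemma coefs_inB P Q : coefs_in P -> coefs_in Q -> coefs_in (P - Q).
Proof. by move=> KP KQ i; rewrite coefB; apply: subringB. Qed.
Lemma coefs_inN P : coefs_in P -> coefs_in (- P).
Proof. by move=> KP i; rewrite coefN; apply: subringN. Qed.
Lemma coefs_inD P Q : coefs_in P -> coefs_in Q -> coefs_in (P + Q).
Proof. by move=> KP KQ i; rewrite coefD; apply: subringD. Qed.
Lemma coefs_inM P Q : coefs_in P -> coefs_in Q -> coefs_in (P * Q).
Proof.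
move=> KP KQ i; rewrite coefM.
by apply: (big_ind K) => [||j _]; [exact: subring0 | exact: subringD | exact: subringM].
Qed.
Lemma coefs_inXn n : coefs_in 'X^n.
Proof.
elim: n => [|n IH]; first by apply: coefs_inC; exact: subring1.
by rewrite exprS; apply: coefs_inM IH; exact: coefs_inX.
Qed.
Lemma coefs_in_deriv P : coefs_in P -> coefs_in P^`().
Proof. by move=> KP i; rewrite coef_deriv; apply: subringMn. Qed.

End Subrings.

Section DerivationGraphs.
Variable R : numFieldType.
Implicit Types (G : dual R -> Prop) (P : {poly (dual R)}).

(** A subring of dual numbers without nonzero multiple of eps is single-valued. *)
Definition derivation_graph G := is_subring G /\ forall a, G (0, a) -> a = 0.

Lemma derivation_graph_coefs G P : derivation_graph G -> coefs_in G P ->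
  map_poly (@re R) P = 0 -> P = 0.
Proof.
move=> [_ Gf] GP P0; apply/polyP => i; rewrite coef0.
move/polyP/(_ i): P0 (GP i); rewrite coef_map coef0 /re.
by case: P`_i => u v /= -> /Gf ->.
Qed.

(** The value a to be given to the derivation at x must satisfy one linear equation
for each polynomial relation of x. Relations of minimal degree have nonzero
derivative at x and determine a; all others follow from one of them, by
pseudo-division. *)
Lemma derivation_value G x : derivation_graph G ->
  exists a, forall P, coefs_in G P ->
    re P.[(x, a) : dual R] = 0 -> P.[(x, a) : dual R] = 0.
Proof.
move=> GG; have [GR Gf] := GG.
pose ann n := `[< exists P, [/\ coefs_in G P, size (map_poly (@re R) P) = n,
   map_poly (@re R) P != 0 & (map_poly (@re R) P).[x] = 0] >].
have [[n annn]|noann] := pselect (exists n, ann n); last first.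
  exists 0 => P GP; rewrite re_horner => Px0.
  suff /(derivation_graph_coefs GG GP) -> : map_poly (@re R) P = 0 by rewrite horner0.
  apply/eqP/negPn/negP => P0; apply: noann.
  by exists (size (map_poly (@re R) P)); apply/asboolP; exists P.
case: (ex_minnP (ex_intro ann n annn)) => m /asboolP[P0 [GP0 sP0 P00 P0x]] min_m.
set p0 := map_poly (@re R) P0 in sP0 P00 P0x.
have sp0 : (1 < size p0)%N.
  rewrite ltnNge; apply/negP => /size1_polyC p0E.
  by move: P0x P00; rewrite p0E hornerC => ->; rewrite polyC0 eqxx.
have p0'x : p0^`().[x] != 0.
  apply/eqP => p0'x0; have p0'0 : p0^`() != 0.
    apply/eqP => /polyP/(_ (size p0).-2); rewrite coef_deriv coef0 prednK -?subn1 ?subn_gt0 //.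
    move/eqP; rewrite mulrn_eq0 subn1 -lead_coefE lead_coef_eq0 (negbTE P00) orbF.
    by rewrite -subn1 subn_eq0 leqNgt sp0.
  have /min_m : ann (size p0^`()).
    apply/asboolP; exists P0^`(); rewrite -deriv_map; split=> //.
    exact: coefs_in_deriv.
  by rewrite -sP0 leqNgt lt_size_deriv.
pose a := - P0.[(x, 0) : dual R].2 / p0^`().[x]; exists a.
have P0a : P0.[(x, a) : dual R] = 0.
  rewrite horner_shift -/p0 /a mulrCA mulfV // mulr1.
  move: (re_horner P0 (x, 0)); rewrite -/p0 {2}/re /= P0x /re.
  by case: P0.[_] => u v /= ->; congr pair; rewrite /= ?addr0 ?subrr.
move=> P; have [k] := ubnP (size (map_poly (@re R) P)).
elim: k P => // k IH P; rewrite ltnS => sP GP; rewrite re_horner /= => Px.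
set p := map_poly _ P in sP Px.
have [/(derivation_graph_coefs GG GP) ->|pN0] := eqVneq p 0; first by rewrite horner0.
have le_p : (size p0 <= size p)%N.
  by rewrite sP0; apply: min_m; apply/asboolP; exists P.
pose c0 := P0`_(size p0).-1; pose c := P`_(size p).-1.
have rc0 : re c0 = lead_coef p0 by rewrite lead_coefE coef_map.
have rc : re c = lead_coef p by rewrite lead_coefE coef_map.
(* cancel the leading terms of the reductions of P and P0 *)
pose Q := c0%:P * P - c%:P * 'X^(size p - size p0) * P0.
have Qre : map_poly (@re R) Q
    = lead_coef p0 *: p - (lead_coef p *: 'X^(size p - size p0)) * p0.
  by rewrite rmorphB !rmorphM /= !map_polyC map_polyXn /= -/p -/p0 rc rc0 !mul_polyC.
have GQ : coefs_in G Q.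
  apply: (coefs_inB GR).
    by apply: (coefs_inM GR) => //; apply: (coefs_inC GR); exact: GP0.
  apply: (coefs_inM GR) => //; apply: (coefs_inM GR); last exact: (coefs_inXn GR).
  by apply: (coefs_inC GR); exact: GP.
have Qx : re Q.[(x, a) : dual R] = 0.
  by rewrite re_horner Qre /re /= !hornerE Px P0x !mulr0 subrr.
have sQ : (size (map_poly (@re R) Q) < k)%N.
  apply: leq_trans sP; have sp : (0 < size p)%N by rewrite size_poly_gt0.
  have sp0' : (0 < size p0)%N by rewrite size_poly_gt0.
  rewrite Qre -(prednK sp) ltnS.
  apply/leq_sizeP => j le_j; rewrite coefB -scalerAl !coefZ coefXnM.
  rewrite ltnNge (leq_trans (leq_sub2l _ sp0')) ?subn1 //= .
  move: le_j; rewrite leq_eqVlt => /orP[/eqP <-|lt_j].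
    have -> : ((size p).-1 - ((size p).-1.+1 - size p0) = (size p0).-1)%N by lia.
    by rewrite -!lead_coefE mulrC subrr.
  rewrite prednK // in lt_j *; rewrite !nth_default ?mulr0 ?subr0 //.
  by move: lt_j le_p; clear; move: (size p) (size p0); lia.
have Qa := IH Q sQ GQ Qx.
apply: (@dual_cancel _ c0); first by rewrite rc0 lead_coef_eq0.
by move: Qa; rewrite /Q hornerD hornerN !hornerM !hornerC P0a mulr0 subr0.
Qed.

(** The subring generated by a graph and (x, a) is the set of values at (x, a) of
polynomials over the graph; it is again a graph for the a found above. *)
Lemma derivation_graph_adjoin G x : derivation_graph G ->
  exists G' : dual R -> Prop, [/\ derivation_graph G', forall z, G z -> G' z
    & exists a, G' (x, a)].
Proof.
move=> GG; have [GR Gf] := GG; have [a Ha] := derivation_value x GG.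
exists (fun z => exists2 P, coefs_in G P & z = P.[(x, a) : dual R]); split.
- split; last first.
    by move=> b [P GP E]; move: (Ha P GP); rewrite -E => /(_ erefl) [->].
  split.
  + by exists 1%:P; rewrite ?hornerC //; apply: (coefs_inC GR); exact: subring1.
  + by move=> _ _ [P GP ->] [Q GQ ->]; exists (P - Q); rewrite ?hornerE //; exact: coefs_inB.
  + by move=> _ _ [P GP ->] [Q GQ ->]; exists (P * Q); rewrite ?hornerM //; exact: coefs_inM.
- by move=> z Gz; exists z%:P; rewrite ?hornerC //; exact: coefs_inC.
- by exists a, 'X; rewrite ?hornerX //; exact: coefs_inX.
Qed.

Definition derivation (D : R -> R) :=
  (forall x y, D (x + y) = D x + D y) /\ (forall x y, D (x * y) = x * D y + D x * y).

(** By Zorn's lemma there is a maximal graph, and its domain is everything because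
any further point could be adjoined. *)
Lemma derivation_extends G : derivation_graph G ->
  exists2 D, derivation D & forall x a, G (x, a) -> D x = a.
Proof.
move=> GG; have [[G1 _ _] _] := GG.
pose ok (H : set (dual R)) := (exists z, H z) ->
  derivation_graph H /\ forall z, G z -> H z.
have [F okF totF|M [okM maxM]] := @Zorn_bigcup (dual R) ok.
  move=> [z0 [X0 FX0 X0z0]].
  have okX X z : F X -> X z -> derivation_graph X /\ forall z, G z -> X z.
    by move=> FX Xz; apply: (okF X FX); exists z.
  have two z w : (\bigcup_(X in F) X)%classic z -> (\bigcup_(X in F) X)%classic w ->
      exists X, [/\ F X, X z & X w].
    move=> [X FX Xz] [Y FY Yw]; case: (totF X Y FX FY) => [XY|YX].
      by exists Y; split=> //; exact: XY.
    by exists X; split=> //; exact: YX.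
  split; last by move=> z Gz; exists X0 => //; exact: (okX X0 z0 FX0 X0z0).2.
  split; last by move=> a [X FX Xa]; exact: (okX X _ FX Xa).1.2 Xa.
  split.
  - by exists X0 => //; exact: subring1 (okX X0 z0 FX0 X0z0).1.1.
  - move=> z w /two H /H[X [FX Xz Xw]]; exists X => //.
    exact: subringB (okX X z FX Xz).1.1 _ _ Xz Xw.
  - move=> z w /two H /H[X [FX Xz Xw]]; exists X => //.
    exact: subringM (okX X z FX Xz).1.1 _ _ Xz Xw.
have [M1|M0] := pselect (exists z, M z); last first.
  case: (maxM G); last by move=> _; split.
  split=> [z Mz|]; first by case: M0; exists z.
  by move=> /(_ _ G1) M1; apply: M0; exists 1.
have [MM GM] := okM M1.
have dom x : exists a, M (x, a).
  have [M' [MM' MsubM' [a M'a]]] := derivation_graph_adjoin x MM.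
  exists a; apply: contrapT => Ma; apply: (maxM M'); last first.
    by move=> _; split=> // z Gz; exact/MsubM'/GM.
  by split=> // /(_ _ M'a).
have [D MD] := choice dom.
have MR := MM.1; have Muniq x a b : M (x, a) -> M (x, b) -> a = b.
  move=> Ma Mb; apply/eqP; rewrite -subr_eq0; apply/eqP/MM.2.
  by move: (subringB MR Ma Mb); congr (M _); congr pair; rewrite /= subrr.
exists D; last by move=> x a /GM Ma; exact: Muniq (MD x) Ma.
split=> x y; apply: Muniq (MD _) _.
  exact: (subringD MR (MD x) (MD y)).
exact: (subringM MR (MD x) (MD y)).
Qed.

(** Differentiation of polynomials is a derivation of K[x], as x is transcendental
over K; extend it. *)
Lemma derivation_transcendental (K : R -> Prop) x : is_subring K ->
  (forall P : {poly R}, coefs_in K P -> P.[x] = 0 -> P = 0) ->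
  exists D, [/\ derivation D, forall y, K y -> D y = 0 & D x = 1].
Proof.
move=> KR Kx.
pose G (z : dual R) := exists2 P : {poly R}, coefs_in K P & z = (P.[x], P^`().[x]).
have GG : derivation_graph G.
  split; last by move=> a [P KP [/esym/(Kx P KP) -> ->]]; rewrite deriv0 horner0.
  split.
  - exists 1%:P; first by apply: (coefs_inC KR); exact: subring1.
    by rewrite hornerC derivC horner0.
  - move=> _ _ [P KP ->] [Q KQ ->]; exists (P - Q); first exact: coefs_inB.
    by rewrite derivB !hornerD !hornerN.
  - move=> _ _ [P KP ->] [Q KQ ->]; exists (P * Q); first exact: coefs_inM.
    by rewrite derivM hornerD !hornerM dualM /= addrC.
have [D DD DG] := derivation_extends GG; exists D; split=> //.
  move=> y Ky; apply: DG; exists y%:P; first exact: coefs_inC.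
  by rewrite derivC hornerC horner0.
by apply: DG; exists 'X; [exact: coefs_inX | rewrite derivX hornerX hornerC].
Qed.

End DerivationGraphs.

(** * Derivations and algebraic independence *)

Section DerivationCalculus.
Variables (R : numFieldType) (D : R -> R).
Hypothesis DD : derivation D.

Lemma derD x y : D (x + y) = D x + D y. Proof. exact: DD.1. Qed.
Lemma derM x y : D (x * y) = x * D y + D x * y. Proof. exact: DD.2. Qed.
Lemma der0 : D 0 = 0.
Proof. by apply: (addrI (D 0)); rewrite -derD !addr0. Qed.
Lemma derN x : D (- x) = - D x.
Proof. by apply: (addrI (D x)); rewrite -derD !subrr der0. Qed.
Lemma derB x y : D (x - y) = D x - D y.
Proof. by rewrite derD derN. Qed.
Lemma der1 : D 1 = 0.
Proof. by have := derM 1 1; rewrite !mulr1 mul1r => /eqP; rewrite -subr_eq subrr eq_sym => /eqP. Qed.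
Lemma derMn x n : D (x *+ n) = D x *+ n.
Proof. by elim: n => [|n IH]; rewrite ?mulr0n ?der0 // !mulrS derD IH. Qed.
Lemma der_sum (I : Type) (s : seq I) (P : pred I) F :
  D (\sum_(i <- s | P i) F i) = \sum_(i <- s | P i) D (F i).
Proof. exact: (big_morph D derD der0). Qed.
Lemma der_sqr x : D (x ^+ 2) = (x * D x) *+ 2.
Proof. by rewrite expr2 derM mulr2n [D x * _]mulrC. Qed.
Lemma der_inv x : D x = 0 -> D x^-1 = 0.
Proof.
have [->|x0 Dx] := eqVneq x 0; first by rewrite invr0.
by have := derM x x^-1; rewrite mulfV // der1 Dx mul0r addr0 => /esym/eqP;
  rewrite mulf_eq0 (negbTE x0) => /eqP.
Qed.
Lemma der_int (m : int) : D m%:~R = 0.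
Proof. by case: m => n; rewrite ?NegzE ?rmorphN ?derN /= ?natz derMn der1 mul0rn ?oppr0. Qed.
Lemma der_rat (q : rat) : D (ratr q) = 0.
Proof. by rewrite /ratr derM !der_inv ?der_int ?mulr0 ?mul0r ?addr0. Qed.

Lemma der_horner (P : {poly R}) x : (forall i, D P`_i = 0) ->
  D P.[x] = P^`().[x] * D x.
Proof.
elim/poly_ind: P => [|P c IH] DP; first by rewrite deriv0 !horner0 der0 mul0r.
have Dc : D c = 0 by move: (DP 0%N); rewrite coefD coefMX coefC /= add0r.
have {}IH : D P.[x] = P^`().[x] * D x.
  apply: IH => k; move: (DP k.+1).
  by rewrite coefD coefMX coefC /= addr0.
by rewrite !derivE !hornerE derD derM Dc IH; ring.
Qed.

(** Differentiating P(x) = 0 gives P'(x) D x = 0; induction on the degree handles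
the case where P'(x) vanishes. *)
Lemma der_root (P : {poly R}) x : (forall i, D P`_i = 0) -> P != 0 -> P.[x] = 0 ->
  D x = 0.
Proof.
have [n] := ubnP (size P); elim: n P => // n IH P; rewrite ltnS => sP DP P0 Px.
have := der_horner x DP; rewrite Px der0 => /esym/eqP; rewrite mulf_eq0.
case/orP=> [/eqP P'x|/eqP //]; have [P'0|P'0] := eqVneq P^`() 0; last first.
  apply: IH P'0 P'x; first exact: leq_trans (lt_size_deriv P0) sP.
  by move=> i; rewrite coef_deriv derMn DP mul0rn.
case/eqP: P0; apply/polyP => -[|i].
  move: Px; rewrite (_ : P = (P`_0)%:P) ?hornerC ?coefC //.
  apply/polyP => -[|i]; rewrite coefC //=.
  by move/polyP/(_ i)/eqP: P'0; rewrite coef_deriv coef0 mulrn_eq0 => /eqP.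
by move/polyP/(_ i)/eqP: P'0; rewrite coef_deriv !coef0 mulrn_eq0 => /eqP.
Qed.

End DerivationCalculus.

Section Uncountable.
Variable R : realType.

(** Cantor's nested intervals, each avoiding one more value of f. *)
Lemma reals_uncountable (T : countType) (f : T -> R) : exists x, forall t, f t != x.
Proof.
pose g n := if unpickle n is Some t then f t else 0.
pose step n (ab : R * R) := let m := (ab.1 + ab.2) / 2 in
  if g n < m then (m, ab.2) else (ab.1, (ab.1 + m) / 2).
pose J := fix J n := if n is n'.+1 then step n' (J n') else (0, 1) : R * R.
have J_lt n : (J n).1 < (J n).2.
  by elim: n => [|n] /=; [lra | rewrite /step; case: ifP => /= _; lra].
have J_step n : (J n).1 <= (J n.+1).1 /\ (J n.+1).2 <= (J n).2.
  by have := J_lt n; rewrite /= /step; case: ifP => /= _; lra.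
have J_mono n k : (J n).1 <= (J (n + k)%N).1 /\ (J (n + k)%N).2 <= (J n).2.
  elim: k => [|k [IH1 IH2]]; first by rewrite addn0.
  have [] := J_step (n + k)%N; rewrite addnS.
  by move=> h1 h2; split; [exact: le_trans h1 | exact: le_trans h2 _].
have J_cross m n : (J m).1 < (J n).2.
  have [h1 _] := J_mono m n; have [_ h2] := J_mono n m; rewrite addnC in h2.
  exact: le_lt_trans h1 (lt_le_trans (J_lt _) h2).
pose E := [set (J n).1 | n in [set: nat]]%classic.
have supE : has_sup E.
  split; first by exists (J 0).1; exists 0%N.
  by exists (J 0).2 => _ [m _ <-]; exact/ltW/J_cross.
have x_lo n : (J n).1 <= sup E by apply: sup_upper_bound => //; exists n.
have x_hi n : sup E <= (J n).2.
  by apply: ge_sup; [exact: supE.1 | move=> _ [m _ <-]; exact/ltW/J_cross].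
exists (sup E) => t; apply/eqP => ft.
have gt : g (pickle t) = sup E by rewrite /g pickleK.
have := x_lo (pickle t).+1; have := x_hi (pickle t).+1; have := J_lt (pickle t).
by rewrite /= /step gt; case: ifP => /=; [lra | move/negbT; rewrite -leNgt; lra].
Qed.

End Uncountable.

Section Genericity.
Variable R : realType.
Implicit Types (S : seq R) (D : R -> R).

Definition kills D S := forall x, x \in S -> D x = 0.

(** The ring generated by S is countable, so some real number is transcendental
over it. *)
Lemma transcendental_derivation S :
  exists x D, [/\ derivation D, kills D S & D x = 1].
Proof.
(* Trees with leaves in nat form a countable type that names the elements of the
   ring generated by S. *)
pose ev := fix ev (t : GenTree.tree nat) : R := match t with
  | GenTree.Leaf n => S`_n
  | GenTree.Node 0 [:: a; b] => ev a - ev b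
  | GenTree.Node 1 [:: a; b] => ev a * ev b
  | GenTree.Node _ _ => 1 end.
pose K x := exists t, ev t = x.
have KR : is_subring K.
  split; first by exists (GenTree.Node 0 [::]).
    by move=> _ _ [a <-] [b <-]; exists (GenTree.Node 0 [:: a; b]).
  by move=> _ _ [a <-] [b <-]; exists (GenTree.Node 1 [:: a; b]).
pose root (l : seq (GenTree.tree nat) * nat) := (rootsR (Poly (map ev l.1)))`_l.2.
have [x xP] := reals_uncountable root; exists x.
have [P KP Px|D [DD DK Dx]] := derivation_transcendental (x := x) KR; last first.
  by exists D; split=> // y /(nthP 0)[n _ <-]; apply: DK; exists (GenTree.Leaf n).
apply/eqP/negPn/negP => P0.
have [l lP] : exists l, map ev l = P :> seq R.
  elim: (P : seq R) (KP : forall i, K (P : seq R)`_i) => [|a s IH] Ks; first by exists [::].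
  have [l ls] := IH (fun i => Ks i.+1); have [t /= ta] := Ks 0%N.
  by exists (t :: l); rewrite /= ls ta.
have xr : x \in rootsR P.
  have := roots_on_rootsR P0; move/(_ x); rewrite in_itv /= => <-.
  by apply/rootP.
by move/eqP: (xP (l, index x (rootsR P))); apply; rewrite /root /= lP polyseqK nth_index.
Qed.

Lemma derivationZ D a : derivation D -> derivation (fun x => a * D x).
Proof. by move=> [DA DM]; split=> x y; rewrite ?DA ?DM; ring. Qed.

Lemma derivation_lincomb (I : finType) (F : I -> R -> R) (a : I -> R) :
  (forall i, derivation (F i)) -> derivation (fun x => \sum_i a i * F i x).
Proof.
move=> DF; split=> x y.
  by rewrite -big_split /=; apply: eq_bigr => i _; rewrite (DF i).1 mulrDr.
rewrite mulr_sumr mulr_suml -big_split /=; apply: eq_bigr => i _.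
by rewrite (DF i).2; ring.
Qed.

Lemma derivation0 : derivation (fun=> 0 : R).
Proof. by split=> x y; rewrite ?addr0 ?mulr0 ?mul0r ?addr0. Qed.

Lemma derivationB D D' a : derivation D -> derivation D' ->
  derivation (fun x => D x - a * D' x).
Proof. by move=> [DA DM] [DA' DM']; split=> x y; rewrite ?DA ?DM ?DA' ?DM'; ring. Qed.

(** Rational multiples and translates of a transcendental number are dense, and
derivations see them up to a rational factor. *)
Lemma transcendental_near S t (eps : R) : 0 < eps ->
  exists x D, [/\ `|x - t| < eps, derivation D, kills D S & D x = 1].
Proof.
move=> eps0; have [z [D [DD DS Dz]]] := transcendental_derivation S.
have [q _ qP] : exists2 q : rat, true & 0 < (ratr q : R) /\ `|ratr q * z| < eps / 2.
  have e2 : 0 < eps / 2 by rewrite divr_gt0.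
  have z1 : 0 < `|z| + 1 by rewrite ltr_wpDl.
  have [q] := rat_in_itvoo (divr_gt0 e2 z1).
  rewrite in_itv /= => /andP[q0 q1]; exists q; split=> //.
  rewrite normrM gtr0_norm //; rewrite ltr_pdivlMr // in q1.
  by apply: le_lt_trans q1; rewrite ler_pM2l // lerDl.
have [q' q'P] := @rat_in_itvoo R (t - eps / 2) (t + eps / 2) ltac:(lra).
rewrite in_itv /= in q'P.
exists (ratr q * z + ratr q'), (fun x => (ratr q)^-1 * D x); split.
- have [_ qz] := qP; move: qz q'P; rewrite !ltr_norml => /andP[h1 h2] /andP[h3 h4].
  by apply/andP; split; lra.
- exact: derivationZ.
- by move=> x /DS ->; rewrite mulr0.
- rewrite (derD DD) (derM DD) !(der_rat DD) mul0r !addr0 Dz mulr1 mulVf //.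
  by have [q0 _] := qP; rewrite gt_eqF.
Qed.

(** The members of x indexed by A, together with derivations witnessing that they
are algebraically independent over S. *)
Definition dual_family (I : finType) (S : seq R) (x : I -> R) (A : {set I}) (D : I -> R -> R) :=
  [/\ forall i, derivation (D i), forall i, kills (D i) S
    & {in A &, forall i j, D i (x j) = (i == j)%:R}].

(** New members are chosen one at a time, transcendental over the previous ones;
the previous derivations are corrected so as to vanish at the new member. *)
Lemma dual_family_extend (I : finType) S (x0 : I -> R) (A : {set I}) (D0 : I -> R -> R)
    (eps : R) : 0 < eps -> dual_family S x0 A D0 ->
  exists x (D : I -> R -> R), [/\ {in A, x =1 x0}, forall i, `|x i - x0 i| < eps
    & dual_family S x [set: I] D].
Proof.
move=> eps0; have [n] := ubnP #|~: A|; elim: n x0 A D0 => // n IH x0 A D0.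
rewrite ltnS => cA [DD DS Dx].
have [A0|[k kA]] := set_0Vmem (~: A).
  exists x0, D0; split=> //; first by move=> i; rewrite subrr normr0.
  have -> : [set: I] = A by rewrite -[A]finset.setCK A0 finset.setC0.
  by [].
rewrite inE in kA.
have [y [E [yk DE Eold Ey]]] :=
  transcendental_near (S ++ [seq x0 i | i <- enum A]) (x0 k) eps0.
pose x1 i := if i == k then y else x0 i.
pose D1 i := if i == k then E else fun z => D0 i z - D0 i y * E z.
have ES : kills E S by move=> z zS; apply: Eold; rewrite mem_cat zS.
have Ex0 i : i \in A -> E (x0 i) = 0.
  by move=> iA; apply: Eold; rewrite mem_cat map_f ?orbT // mem_enum.
have [||x [D [xE xx1 DxD]]] := IH x1 (k |: A) D1.
- apply: leq_trans cA; rewrite [X in (_ < X)%N](cardsD1 k) inE kA add1n ltnS.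
  by apply/subset_leq_card/fintype.subsetP => i; rewrite !inE negb_or.
- split.
  + by move=> i; rewrite /D1; case: eqP => // _; exact: derivationB.
  + move=> i z zS; rewrite /D1; case: eqP => _; first exact: ES.
    by rewrite (DS _ _ zS) (ES _ zS) mulr0 subr0.
  + move=> i j; rewrite !inE /D1 /x1.
    have [->|ik] := eqVneq i k; have [->|jk] := eqVneq j k => //= iA jA.
    * by rewrite Ex0.
    * by rewrite Ey mulr1 subrr (negbTE ik).
    * by rewrite Ex0 // mulr0 subr0 Dx.
- exists x, D; split=> //.
    move=> i iA; rewrite xE ?inE ?iA ?orbT // /x1; case: eqP => // ik.
    by rewrite -ik iA in kA.
  move=> i; have [->|ik] := eqVneq i k; first by rewrite xE ?inE ?eqxx // /x1 eqxx.
  by have := xx1 i; rewrite /x1 (negbTE ik).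
Qed.

End Genericity.

Section DualGeneric.
Variable R : realType.

(** Chain rule. *)
Lemma der_meval n (a : 'I_n -> R) (D : R -> R) i (P : mpoly n rat) : derivation D ->
  (forall j, D (a j) = (i == j)%:R) ->
  D (meval a (map_mpoly (@ratr R) P)) = meval a (map_mpoly (@ratr R) (mderiv i P)).
Proof.
move=> DD Da; pose ev Q := meval a (map_mpoly (@ratr R) Q).
pose ok Q := D (ev Q) = ev (mderiv i Q).
have okM Q Q' : ok Q -> ok Q' -> ok (Q * Q').
  rewrite /ok /ev mderivM rmorphD !rmorphM /= => h h'.
  by rewrite mevalD !mevalM (derM DD) h h' addrC.
have okC c : ok (mpolyC n c).
  by rewrite /ok /ev mderivC !rmorph0 map_mpolyC mevalC der_rat.
have okX j : ok (mpolyX rat (mnm1 j)).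
  rewrite /ok /ev mderivX map_mpolyX mevalXU Da mnm1E.
  have [<-|ij] := eqVneq j i; last first.
    by rewrite scale0r !rmorph0.
  rewrite scale1r (_ : mnm_sub _ _ = mnm0) ?mpolyX0 ?rmorph1 //.
  by apply/mnmP => k; rewrite mnmBE mnm0E subnn.
have {}okX m : ok (mpolyX rat m).
  rewrite mpolyXE_id; apply: (big_ind ok) => //; first exact: (okC 1).
  by move=> j _; elim: (m j) => [|k IH]; [exact: (okC 1) | rewrite exprS; exact: okM].
elim/mpolyind: P; first by rewrite mderiv0 !rmorph0 der0.
move=> c m P _ _ IH; rewrite mderivD !rmorphD /= (derD DD) IH; congr (_ + _).
by rewrite -mul_mpolyC; apply: okM.
Qed.

(** Applying the dual derivations to a relation of minimal degree gives the partial
derivatives as relations of lower degree; these vanish identically, so the relation is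
constant. *)
Lemma dual_alg_independent n (a : 'I_n -> R) (D : 'I_n -> R -> R) :
  (forall i, derivation (D i)) -> (forall i j, D i (a j) = (i == j)%:R) ->
  alg_independent a.
Proof.
move=> DD Da P; have [k] : exists k, forall m, m \in msupp P -> (mdeg m < k)%N.
  exists (msize P) => m mP; exact: msize_mdeg_lt.
elim: k P => [|k IH] P Pk Pa.
  apply/eqP; rewrite -msupp_eq0; case: (msupp P) Pk => // m s /(_ m).
  by rewrite inE eqxx => /(_ isT).
have dP i : mderiv i P = 0.
  apply: IH; last by rewrite -(der_meval _ (DD i) (Da i)) Pa der0.
  move=> m; rewrite mcoeff_msupp mcoeff_mderiv mulrn_eq0 negb_or /= => mP.
  have := Pk (mnm_add m (mnm1 i)); rewrite mcoeff_msupp mP => /(_ isT).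
  by rewrite mdegD mdeg1 addn1 ltnS.
have PC : P = mpolyC n (mcoeff mnm0 P).
  apply/mpolyP => m; rewrite mcoeffC; have [->|m0] := eqVneq m mnm0.
    by rewrite mulr1.
  have [i mi] : exists i, (0 < m i)%N.
    by apply/existsP; apply: contraNT m0; rewrite negb_exists => /forallP m0;
      apply/eqP/mnmP => i; rewrite mnm0E; move: (m0 i); rewrite lt0n negbK => /eqP.
  move/mpolyP/(_ (mnm_sub m (mnm1 i)))/eqP: (dP i).
  rewrite mcoeff_mderiv mcoeff0 submK ?mnm1E ?lep1mP -?lt0n //.
  by rewrite mulrn_eq0 /= mulr0 => /eqP.
move: Pa; rewrite PC map_mpolyC mevalC => /eqP.
by rewrite fmorph_eq0 => /eqP ->.
Qed.

Lemma dual_generic (V : finType) d (p : V -> 'rV[R]_d) S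
    (D : V * 'I_d -> R -> R) :
  dual_family S (fun i => p i.1 0 i.2) [set: V * 'I_d] D -> generic p.
Proof.
case=> DD _ Dp; apply: (dual_alg_independent (D := fun k => D (enum_val k))) => // i j.
by rewrite /coordinates Dp ?inE // (inj_eq enum_val_inj).
Qed.

End DualGeneric.

(** * Rigid frameworks and quantifier elimination *)

Section LocallyConstant.
Variable R : realType.

Fixpoint term_consts (t : GRing.term R) : seq R :=
  match t with
  | GRing.Const c => [:: c]
  | GRing.Add u v | GRing.Mul u v => term_consts u ++ term_consts v
  | GRing.Opp u | GRing.NatMul u _ | GRing.Inv u | GRing.Exp u _ => term_consts u
  | _ => [::]
  end.

Fixpoint formula_consts (f : ord.formula R) : seq R :=
  match f with
  | ord.Equal u v | ord.Lt u v | ord.Le u v => term_consts u ++ term_consts v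
  | ord.And f g | ord.Or f g | ord.Implies f g => formula_consts f ++ formula_consts g
  | ord.Not f => formula_consts f
  | _ => [::]
  end.

Lemma kills_cat (D : R -> R) s t : kills D (s ++ t) -> kills D s /\ kills D t.
Proof. by move=> K; split=> x xs; apply: K; rewrite mem_cat xs ?orbT. Qed.

Lemma is_subring_ker (D : R -> R) : derivation D -> is_subring (fun x => D x = 0).
Proof.
move=> DD; split; first exact: der1.
  by move=> x y Dx Dy; rewrite (derB DD) Dx Dy subrr.
by move=> x y Dx Dy; rewrite (derM DD) Dx Dy mulr0 mul0r addr0.
Qed.

Variables (D : R -> R) (e : seq R) (i : nat) (v0 : R).
Hypotheses (DD : derivation D) (De : forall j, j != i -> D e`_j = 0) (Dv0 : D v0 != 0).
Let KR := is_subring_ker DD.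

(** As a function of its i-th variable alone, a term is a polynomial whose
coefficients are killed by D. *)
Lemma eval_term_poly t : GRing.rterm t -> kills D (term_consts t) ->
  exists2 P : {poly R}, coefs_in (fun x => D x = 0) P
    & forall v, GRing.eval (set_nth 0 e i v) t = P.[v].
Proof.
elim: t => //=.
- move=> n _ _; have [->|ni] := eqVneq n i.
    by exists 'X => [|v]; [exact: coefs_inX | rewrite nth_set_nth /= eqxx hornerX].
  exists (e`_n)%:P => [|v]; first by apply: (coefs_inC KR); exact: De.
  by rewrite nth_set_nth /= (negbTE ni) hornerC.
- move=> c _ kc; exists c%:P => [|v]; last by rewrite hornerC.
  by apply: (coefs_inC KR); apply: kc; rewrite mem_head.
- move=> n _ _; exists n%:R%:P => [|v]; last by rewrite hornerC.
  by apply: (coefs_inC KR); rewrite (derMn DD) der1 // mul0rn.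
- move=> t1 IH1 t2 IH2 /andP[/IH1{}IH1 /IH2{}IH2] /kills_cat[/IH1[P KP EP] /IH2[Q KQ EQ]].
  by exists (P + Q) => [|v]; [exact: coefs_inD | rewrite EP EQ hornerD].
- move=> t1 IH1 /IH1{}IH1 /IH1[P KP EP]; exists (- P) => [|v]; first exact: coefs_inN.
  by rewrite EP hornerN.
- move=> t1 IH1 n /IH1{}IH1 /IH1[P KP EP]; exists (n%:R%:P * P) => [|v].
    apply: (coefs_inM KR) => //; apply: (coefs_inC KR).
    by rewrite (derMn DD) der1 // mul0rn.
  by rewrite EP hornerM hornerC mulr_natl.
- move=> t1 IH1 t2 IH2 /andP[/IH1{}IH1 /IH2{}IH2] /kills_cat[/IH1[P KP EP] /IH2[Q KQ EQ]].
  by exists (P * Q) => [|v]; [exact: coefs_inM | rewrite EP EQ hornerM].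
- move=> t1 IH1 n /IH1{}IH1 /IH1[P KP EP]; exists (P ^+ n) => [|v].
    elim: n => [|n IH]; last by rewrite exprS; exact: coefs_inM.
    by rewrite expr0; apply: (coefs_inC KR); exact: der1.
  by rewrite EP horner_exp.
Qed.

(** By der_root, a polynomial with coefficients killed by D does not vanish at v0
unless it is zero, so it has constant sign near v0. *)
Lemma eval_term_sign t1 t2 : GRing.rterm t1 -> GRing.rterm t2 ->
    kills D (term_consts t1 ++ term_consts t2) ->
  let s v := Num.sg (GRing.eval (set_nth 0 e i v) t1 - GRing.eval (set_nth 0 e i v) t2) in
  exists2 eps : R, 0 < eps & forall v, `|v - v0| < eps -> s v = s v0.
Proof.
move=> r1 r2 /kills_cat[/(eval_term_poly r1)[P KP EP] /(eval_term_poly r2)[Q KQ EQ]] s.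
have sE v : s v = Num.sg (P - Q).[v] by rewrite /s EP EQ hornerD hornerN.
have [PQ|PQ] := eqVneq (P - Q) 0; first by exists 1 => // v _; rewrite !sE PQ !horner0.
have PQv0 : (P - Q).[v0] != 0.
  apply: contra Dv0 => /eqP PQ0; apply/eqP/(der_root DD _ PQ PQ0).
  exact: (coefs_inB KR KP KQ).
have [|eps eps0 Heps] := @poly_cont _ v0 (P - Q) `|(P - Q).[v0]|.
  by rewrite normr_gt0.
exists eps => // v /Heps; rewrite !sE.
case: (ltgtP (P - Q).[v0] 0) PQv0 => // c0 _.
  by rewrite (ltr0_norm c0) ltr_norml => /andP[_ h]; rewrite !ltr0_sg //; lra.
by rewrite (gtr0_norm c0) ltr_norml => /andP[h _]; rewrite !gtr0_sg //; lra.
Qed.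

(** The truth value depends only on the signs of finitely many polynomials, which
are locally constant by eval_term_sign. *)
Lemma qf_eval_locally_constant f : ord.rformula f -> kills D (formula_consts f) ->
  exists2 eps : R, 0 < eps & forall v, `|v - v0| < eps ->
    ord.qf_eval (set_nth 0 e i v) f = ord.qf_eval (set_nth 0 e i v0) f.
Proof.
have two (P Q : R -> Prop) : (exists2 eps : R, 0 < eps & forall v, `|v - v0| < eps -> P v) ->
    (exists2 eps : R, 0 < eps & forall v, `|v - v0| < eps -> Q v) ->
    (exists2 eps : R, 0 < eps & forall v, `|v - v0| < eps -> P v /\ Q v).
  move=> [a a0 Ha] [b b0 Hb]; exists (Num.min a b); first by rewrite lt_min a0.
  by move=> v; rewrite lt_min => /andP[va vb]; split; [exact: Ha | exact: Hb].
elim: f => /=.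
- by exists 1.
- move=> t1 t2 /andP[r1 r2] /(eval_term_sign r1 r2)[eps eps0 H]; exists eps => // v /H E.
  by rewrite -subr_eq0 -sgr_eq0 -[in RHS]subr_eq0 -[in RHS]sgr_eq0 E.
- move=> t1 t2 /andP[r1 r2] /(eval_term_sign r1 r2)[eps eps0 H]; exists eps => // v /H E.
  by rewrite -subr_lt0 -sgr_lt0 -[in RHS]subr_lt0 -[in RHS]sgr_lt0 E.
- move=> t1 t2 /andP[r1 r2] /(eval_term_sign r1 r2)[eps eps0 H]; exists eps => // v /H E.
  by rewrite -subr_le0 -sgr_le0 -[in RHS]subr_le0 -[in RHS]sgr_le0 E.
- by [].
- move=> f IHf g IHg /andP[/IHf{}IHf /IHg{}IHg] /kills_cat[/IHf{}IHf /IHg{}IHg].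
  by have [eps eps0 H] := two _ _ IHf IHg; exists eps => // v /H[-> ->].
- move=> f IHf g IHg /andP[/IHf{}IHf /IHg{}IHg] /kills_cat[/IHf{}IHf /IHg{}IHg].
  by have [eps eps0 H] := two _ _ IHf IHg; exists eps => // v /H[-> ->].
- move=> f IHf g IHg /andP[/IHf{}IHf /IHg{}IHg] /kills_cat[/IHf{}IHf /IHg{}IHg].
  by have [eps eps0 H] := two _ _ IHf IHg; exists eps => // v /H[-> ->].
- by move=> f IHf /IHf{}IHf /IHf[eps eps0 H]; exists eps => // v /H ->.
- by exists 1.
- by exists 1.
Qed.
End LocallyConstant.

Section SquaredDistance.
Variables (R : realType) (d : nat).
Implicit Types a b c : 'rV[R]_d.

Definition sqd a b : R := \sum_j (a 0 j - b 0 j) ^+ 2.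

Lemma sqd_ge0 a b : 0 <= sqd a b.
Proof. by apply: sumr_ge0 => j _; exact: sqr_ge0. Qed.

Lemma enormBE a b : enorm (a - b) = Num.sqrt (sqd a b).
Proof. by congr Num.sqrt; apply: eq_bigr => j _; rewrite !mxE. Qed.

(** Squared distances are polynomials in the coordinates, which derivations can
handle, so they replace distances from here on. *)
Lemma enormB_eq a b a' b' : enorm (a - b) = enorm (a' - b') <-> sqd a b = sqd a' b'.
Proof.
rewrite !enormBE; split=> [/eqP|->//].
by rewrite eqr_sqrt ?sqd_ge0 // => /eqP.
Qed.

Lemma sqdC a b : sqd a b = sqd b a.
Proof. by apply: eq_bigr => j _; rewrite -opprB sqrrN. Qed.

Lemma sqd_eq0 a b : sqd a b = 0 <-> a = b.
Proof.
split=> [/eqP|->]; last by rewrite /sqd big1 // => j _; rewrite subrr expr0n.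
rewrite psumr_eq0 => [/allP ab|j _]; last exact: sqr_ge0.
apply/rowP => j; apply/eqP; rewrite -subr_eq0 -sqrf_eq0.
by apply: ab; rewrite mem_index_enum.
Qed.

Lemma der_sqd (D : R -> R) a b : derivation D ->
  D (sqd a b) = (\sum_j (a 0 j - b 0 j) * (D (a 0 j) - D (b 0 j))) *+ 2.
Proof.
move=> DD; rewrite (der_sum DD) -sumrMnl; apply: eq_bigr => j _.
by rewrite (der_sqr DD) (derB DD).
Qed.

End SquaredDistance.

Section FirstOrder.
Variables (R : realType) (T : finType).

Definition upd (env : T -> R) (i : T) (v : R) j := if j == i then v else env j.

Lemma set_nth_codom (env : T -> R) i v :
  set_nth 0 (codom env) (enum_rank i) v = codom (upd env i v).
Proof.
apply: (@eq_from_nth _ 0); first by rewrite size_set_nth !size_codom; apply/maxn_idPr.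
move=> k; rewrite size_set_nth size_codom (maxn_idPr _) // => kT.
rewrite nth_set_nth /= [RHS](nth_codom 0 _ (Ordinal kT)) /upd.
rewrite (can2_eq (@enum_valK T) (@enum_rankK T)).
rewrite -(inj_eq val_inj) /=; case: eqP => // _.
exact: (nth_codom 0 _ (Ordinal kT)).
Qed.

(** First-order formulas have numbered variables; here they are indexed by a finite
type T and environments are functions on T. *)
Definition fo_var (i : T) : GRing.term R := GRing.Var R (enum_rank i).

Lemma holds_exists (env : T -> R) (s : seq T) f :
  ord.holds (codom env) (foldr (fun i => ord.Exists (enum_rank i)) f s) <->
  exists2 env', {in [predC s], env' =1 env} & ord.holds (codom env') f.
Proof.
elim: s env => [|i s IH] env /=.
  split=> [h|[env' E h]]; first by exists env.
  by rewrite -(_ : codom env' = codom env) //; apply: eq_codom => j; apply: E.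
split=> [[v]|[env' E h]].
  rewrite set_nth_codom => /IH[env' E h]; exists env' => // j.
  rewrite !inE negb_or => /andP[ji js].
  by rewrite E ?inE // /upd (negbTE ji).
exists (env' i); rewrite set_nth_codom; apply/IH; exists env' => // j js.
rewrite /upd; case: eqP => [->//|/eqP ji]; apply: E.
by rewrite !inE negb_or ji.
Qed.

Definition fo_all (I : Type) (F : I -> ord.formula R) (s : seq I) :=
  foldr (fun i => ord.And (F i)) (ord.Bool true) s.

Lemma holds_all e (I : eqType) (F : I -> ord.formula R) s :
  ord.holds e (fo_all F s) <-> {in s, forall i, ord.holds e (F i)}.
Proof.
elim: s => [|i s IH] /=; first by [].
split=> [[Fi /IH Fs] j|h].
  by rewrite inE => /predU1P[->//|]; exact: Fs.
split; first by apply: h; rewrite mem_head.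
by apply/IH => j js; apply: h; rewrite inE js orbT.
Qed.

Definition fo_sum (I : Type) (F : I -> GRing.term R) (s : seq I) :=
  foldr (fun i => GRing.Add (F i)) (GRing.NatConst R 0) s.

Lemma eval_fo_sum e (I : Type) (F : I -> GRing.term R) s :
  GRing.eval e (fo_sum F s) = \sum_(i <- s) GRing.eval e (F i).
Proof. by elim: s => [|i s IH] /=; rewrite ?big_nil // big_cons IH. Qed.

End FirstOrder.

Section RigidityConstants.
Variables (R : realType) (d : nat) (V : finType) (G : sgraph V).
Local Notation coord := (V * 'I_d)%type.
Local Notation vars := (coord + (coord + (coord + (V * V + unit))))%type.
Local Notation pos x j := (inl (x, j) : vars).
Local Notation lo x j := (inr (inl (x, j)) : vars).
Local Notation hi x j := (inr (inr (inl (x, j))) : vars).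
Local Notation len x y := (inr (inr (inr (inl (x, y)))) : vars).
Local Notation val := (inr (inr (inr (inr tt))) : vars).
Local Notation X i := (fo_var R i).

Definition sqd_term (x y : V) : GRing.term R :=
  fo_sum (fun j => GRing.Exp (GRing.Add (X (pos x j)) (GRing.Opp (X (pos y j)))) 2)
    (enum 'I_d).

(** The formula stating that some framework (the variables pos) has the edge lengths
len, lies in the open box between lo and hi, and has squared distance val between a
and b. The box is given by variables and not by constants, so that the eliminated
formula does not depend on the framework to which it is applied. *)
Definition realizable (a b : V) : ord.formula R :=
  foldr (fun i => ord.Exists (enum_rank i))
   (ord.And (fo_all (fun e : V * V => ord.Equal (sqd_term e.1 e.2) (X (len e.1 e.2)))
              [seq e <- enum {: V * V} | G e.1 e.2])
   (ord.And (fo_all (fun c : coord => ord.And (ord.Lt (X (lo c.1 c.2)) (X (pos c.1 c.2)))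
                       (ord.Lt (X (pos c.1 c.2)) (X (hi c.1 c.2)))) (enum {: coord}))
   (ord.Equal (sqd_term a b) (X val))))
   [seq pos c.1 c.2 | c <- enum {: coord}].

Lemma holds_realizable (env : vars -> R) a b :
  ord.holds (codom env) (realizable a b) <->
  exists q : V -> 'rV[R]_d, [/\ forall x y, G x y -> sqd (q x) (q y) = env (len x y),
     forall x j, env (lo x j) < q x 0 j < env (hi x j) & sqd (q a) (q b) = env val].
Proof.
rewrite holds_exists; pose cfg (env' : vars -> R) x : 'rV[R]_d := \row_j env' (pos x j).
have sqdE env' x y : GRing.eval (codom env') (sqd_term x y) = sqd (cfg env' x) (cfg env' y).
  rewrite eval_fo_sum big_enum /=; apply: eq_bigr => j _.
  by rewrite !mxE !nth_codom !enum_rankK.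
have notpos (i : vars) : i \in [predC [seq pos c.1 c.2 | c <- enum {: coord}]]
    = if i is inl _ then false else true.
  rewrite !inE; case: i => [[x j]|i]; last by apply/negP => /mapP[].
  by apply/negbF/mapP; exists (x, j) => //; rewrite mem_enum.
split=> [[env' E [/holds_all hE [/holds_all hB hV]]]|[q [qE qB qV]]].
  exists (cfg env'); split.
  - move=> x y xy; move: (hE (x, y)); rewrite mem_filter xy mem_enum => /(_ isT) /=.
    by rewrite sqdE nth_codom enum_rankK E // notpos.
  - move=> x j; move: (hB (x, j)); rewrite mem_enum => /(_ isT) /=.
    by rewrite !nth_codom !enum_rankK mxE (E (lo x j)) ?(E (hi x j)) ?notpos // => -[-> ->].
  - by move: hV; rewrite /= sqdE nth_codom enum_rankK E // notpos.
pose env' (i : vars) := if i is inl c then q c.1 0 c.2 else env i.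
have cfgE : cfg env' = q by apply/funext => x; apply/rowP => j; rewrite mxE.
exists env'; first by move=> i; rewrite notpos; case: i.
split; first apply/holds_all.
  move=> [x y]; rewrite mem_filter /= => /andP[xy _].
  by rewrite sqdE nth_codom enum_rankK cfgE qE.
split; first apply/holds_all.
  by move=> [x j] _; rewrite /= !nth_codom !enum_rankK /=; apply/andP; exact: qB.
by rewrite /= sqdE nth_codom enum_rankK cfgE qV.
Qed.


Definition eliminated (f : ord.formula R) :=
  ord.quantifier_elim (@wproj R) (ord.to_rform f).

Lemma eliminatedP e f : reflect (ord.holds e f) (ord.qf_eval e (eliminated f)).
Proof. exact: rcf_satP. Qed.

Lemma rformula_eliminated f : ord.rformula (eliminated f).
Proof.
have := ord.quantifier_elim_wf (@wf_QE_wproj R) (ord.to_rform_rformula f).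
by case/andP.
Qed.

(** The constants are those of the eliminated formulas of realizable. If a
derivation killed the edge lengths and the constants but not the distance t from a to
b, then by qf_eval_locally_constant the value t could be varied in the eliminated
formula, and an equivalent framework near p would have another distance. *)
Lemma rigidity_constants : exists k : seq R,
  forall p : V -> 'rV[R]_d, rigid_framework G p ->
  forall D, derivation D -> kills D k ->
  (forall x y, G x y -> D (sqd (p x) (p y)) = 0) ->
  forall a b, D (sqd (p a) (p b)) = 0.
Proof.
exists (flatten [seq formula_consts (eliminated (realizable e.1 e.2)) | e <- enum {: V * V}]).
move=> p [eps eps0 rig] D DD Dk Dlen a b; apply/eqP/negPn/negP => Dt.
set t := sqd (p a) (p b) in Dt.
have {Dk}Dab : kills D (formula_consts (eliminated (realizable a b))).
  move=> x xk; apply: Dk; apply/flattenP; exists (formula_consts (eliminated (realizable a b))) => //.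
  by apply/mapP; exists (a, b) => //; rewrite mem_enum.
(* A box of half-side eps / (d + 1) lies in the ball of radius eps. *)
pose del : R := eps / d.+1%:R.
have del0 : 0 < del by rewrite divr_gt0 // ltr0n.
have /choice[l lP] : forall c : coord, exists q : rat, p c.1 0 c.2 - del < ratr q < p c.1 0 c.2.
  move=> c; have [|q] := @rat_in_itvoo R (p c.1 0 c.2 - del) (p c.1 0 c.2).
    by rewrite ltrBlDr ltrDl.
  by rewrite in_itv; exists q.
have /choice[h hP] : forall c : coord, exists q : rat, p c.1 0 c.2 < ratr q < p c.1 0 c.2 + del.
  move=> c; have [|q] := @rat_in_itvoo R (p c.1 0 c.2) (p c.1 0 c.2 + del).
    by rewrite ltrDl.
  by rewrite in_itv; exists q.
pose env (i : vars) : R := match i with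
  | inl _ => 0 | inr (inl c) => ratr (l c) | inr (inr (inl c)) => ratr (h c)
  | inr (inr (inr (inl (x, y)))) => if G x y then sqd (p x) (p y) else 0
  | val => t end.
have Denv j : j != enum_rank val :> nat -> D (codom env)`_j = 0.
  move=> jv; have [jT|jT] := ltnP j #|{: vars}|; last first.
    by rewrite nth_default ?size_codom // (der0 DD).
  rewrite (nth_codom 0 env (Ordinal jT)).
  have : enum_val (Ordinal jT) != val.
    by apply: contraNneq jv => E; rewrite -E enum_valK.
  case: (enum_val _) => [_|[c|[c|[[x y]|[]]]]] //= _; rewrite ?(der0 DD) ?der_rat //.
  by case: ifP => [/Dlen//|_]; rewrite (der0 DD).
have [e e0 He] := qf_eval_locally_constant DD Denv Dt (rformula_eliminated (realizable a b)) Dab.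
have := He (t + e / 2); rewrite addrAC subrr add0r gtr0_norm ?divr_gt0 //.
rewrite ltr_pdivrMr // ltr_pMr // ltr1n => /(_ isT).
rewrite !set_nth_codom => E.
have /eliminatedP : ord.holds (codom (upd env val t)) (realizable a b).
  apply/holds_realizable; exists p; split=> //=.
    by move=> x y xy; rewrite /upd /= xy.
  move=> x j; rewrite /upd /=.
  by have /andP[_ ->] := lP (x, j); have /andP[-> _] := hP (x, j).
rewrite -E => /eliminatedP/holds_realizable[q [qE qB]]; rewrite /upd eqxx => qt.
have pq : congruent p q.
  apply: rig => [x y xy|x].
    by apply/enormB_eq; rewrite qE // /upd /= xy.
  rewrite enormBE -(gtr0_norm eps0) -sqrtr_sqr ltr_sqrt ?exprn_gt0 //.
  apply: (@le_lt_trans _ _ (\sum_(j < d) del ^+ 2)).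
    apply: ler_sum => j _; rewrite -real_normK ?num_real // ler_pXn2r ?nnegrE ?normr_ge0 ?(ltW del0) //.
    move: (qB x j) (lP (x, j)) (hP (x, j)); rewrite /upd /= => /andP[q1 q2] /andP[l1 l2] /andP[h1 h2].
    by apply: ltW; rewrite ltr_norml; apply/andP; split; lra.
  rewrite sumr_const card_ord -mulr_natr.
  have -> : eps = del * d.+1%:R by rewrite /del divfK // pnatr_eq0.
  rewrite [ltRHS]exprMn ltr_pM2l ?exprn_gt0 // -natrX ltr_nat.
  by rewrite -mulnn; lia.
move/(_ a b)/enormB_eq: pq; rewrite qt -/t => /eqP; rewrite -subr_eq0 opprD addNKr oppr_eq0.
by rewrite gt_eqF // divr_gt0.
Qed.

End RigidityConstants.

(** * Linear algebra of infinitesimal motions *)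

Section LinearAlgebra.
Variables (R : realType) (d : nat).

Lemma mulmx_trE (u v : 'rV[R]_d) : (u *m v^T) 0 0 = \sum_j u 0 j * v 0 j.
Proof. by rewrite mxE; apply: eq_bigr => j _; rewrite mxE. Qed.

Lemma sqdE (a b : 'rV[R]_d) : sqd a b = ((a - b) *m (a - b)^T) 0 0.
Proof. by rewrite mulmx_trE; apply: eq_bigr => j _; rewrite !mxE expr2. Qed.

Lemma sqd_orthogonal (M : 'M[R]_d) (a b a' b' : 'rV[R]_d) : M *m M^T = 1%:M ->
  a' - b' = (a - b) *m M -> sqd a' b' = sqd a b.
Proof. by move=> MM E; rewrite !sqdE E trmx_mul mulmxA -(mulmxA _ M) MM mulmx1. Qed.

Lemma linear_dependence (A B : finType) (F : A -> B -> R) : (#|B| < #|A|)%N ->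
  exists2 l : A -> R, exists a, l a != 0 & forall b, \sum_a l a * F a b = 0.
Proof.
move=> BA; pose M : 'M[R]_(#|A|, #|B|) := \matrix_(i, j) F (enum_val i) (enum_val j).
have : kermx M != 0.
  by rewrite kermx_eq0 /row_free neq_ltn (leq_ltn_trans (rank_leq_col M)).
case/rowV0Pn => v /sub_kermxP vM v0; exists (fun a => v 0 (enum_rank a)).
  apply/existsP; apply: contraNT v0; rewrite negb_exists => /forallP v0.
  apply/eqP/rowP => i; rewrite mxE; apply/eqP; move: (v0 (enum_val i)).
  by rewrite enum_valK negbK.
move=> b; move/rowP/(_ (enum_rank b)): vM; rewrite !mxE => E; rewrite -[RHS]E.
rewrite (reindex (@enum_val A A)) /=; last by apply: onW_bij; exact: enum_val_bij.
by apply: eq_bigr => i _; rewrite mxE !enum_valK enum_rankK.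
Qed.

(** Suppose u P = 0 with u nonzero at i. Differentiating with the derivation dual
to the entry (i, j) puts the j-th unit vector in the row space of P, for all j, so P
has rank d. *)
Lemma dual_row_free r (P : 'M[R]_(r, d)) (D : 'I_r -> 'I_d -> R -> R) : (r <= d)%N ->
  (forall i j, derivation (D i j)) ->
  (forall i j k l, D i j (P k l) = ((i == k) && (j == l))%:R) -> row_free P.
Proof.
move=> rd DD DP; rewrite -kermx_eq0; apply/negPn/negP => /rowV0Pn[u /sub_kermxP uP u0].
have [i ui] : exists i, u 0 i != 0.
  apply/existsP; apply: contraNT u0; rewrite negb_exists => /forallP u0.
  by apply/eqP/rowP => i; rewrite mxE; apply/eqP; move: (u0 i); rewrite negbK.
have eP j : ((delta_mx 0 j : 'rV_d) <= P)%MS.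
  pose Du : 'rV[R]_r := \row_k D i j (u 0 k).
  suff -> : delta_mx 0 j = (- (u 0 i)^-1 *: Du) *m P by rewrite submxMl.
  apply/rowP => l; rewrite -scalemxAl !mxE eqxx /=.
  have : \sum_k D i j (u 0 k * P k l) = 0.
    by rewrite -(der_sum (DD i j)); move/rowP/(_ l): uP; rewrite !mxE => ->; rewrite der0.
  rewrite (eq_bigr (fun k => u 0 k * ((i == k) && (j == l))%:R + D i j (u 0 k) * P k l));
    last by move=> k _; rewrite (derM (DD i j)) DP.
  rewrite big_split /= (bigD1 i) //= eqxx big1 ?addr0 => [|k /negbTE ki]; last first.
    by rewrite eq_sym ki mulr0.
  rewrite addrC => /eqP; rewrite addr_eq0 => /eqP E.
  have -> : \sum_k Du 0 k * P k l = \sum_k D i j (u 0 k) * P k l.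
    by apply: eq_bigr => k _; rewrite mxE.
  by rewrite E mulrN mulNr opprK mulrA mulVf // mul1r eq_sym.
have /mxrankS : (1%:M <= P)%MS by apply/row_subP => j; rewrite row1.
rewrite mxrank1 => dP; have /negP := u0; apply.
rewrite -(mulmx_free_eq0 u (_ : row_free P)) ?uP //.
by rewrite /row_free eqn_leq rank_leq_row (leq_trans rd).
Qed.

(** The rows of O are found from the last one backwards: row j must be orthogonal to
the rows i < j of B and to the rows of O already found, d - 1 vectors in all. *)
Lemma orthogonal_triangulation (B : 'M[R]_d) :
  exists2 O : 'M[R]_d, O *m O^T = 1%:M & forall i j : 'I_d, (i < j)%N -> (B *m O^T) i j = 0.
Proof.
suff /(_ d (leqnn d))[f fO fB] : forall k, (k <= d)%N -> exists2 f : 'I_d -> 'rV[R]_d,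
    forall i j : 'I_d, (d - k <= i)%N -> (d - k <= j)%N -> (f i *m (f j)^T) 0 0 = (i == j)%:R
  & forall i j : 'I_d, (i < j)%N -> (d - k <= j)%N -> (row i B *m (f j)^T) 0 0 = 0.
  exists (\matrix_i f i).
    apply/matrixP => i j; rewrite !mxE -fO ?subnn // mulmx_trE.
    by apply: eq_bigr => l _; rewrite !mxE.
  move=> i j ij; rewrite -(fB i j ij) ?subnn // mulmx_trE mxE.
  by apply: eq_bigr => l _; rewrite !mxE.
elim=> [_|k IH kd].
  by exists (fun=> 0) => [i j|i j _]; rewrite subn0 leqNgt ltn_ord.
have [f fO fB] := IH (ltnW kd).
have j0P : (d - k.+1 < d)%N by lia.
pose j0 := Ordinal j0P.
(* The zero row j0 makes C singular, which provides the new vector. *)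
pose C : 'M[R]_d := \matrix_i (if (i < j0)%N then row i B else if i == j0 then 0 else f i).
have /det0P[v v0 vC] : \det C^T == 0.
  rewrite det_tr; apply/det0P; exists (delta_mx 0 j0).
    by apply/eqP => /matrixP/(_ 0 j0)/eqP; rewrite !mxE !eqxx oner_eq0.
  by rewrite -rowE; apply/rowP => j; rewrite !mxE ltnn eqxx mxE.
have vCi i : (row i C *m v^T) 0 0 = 0.
  move/rowP/(_ i): vC; rewrite [in X in X -> _]mxE mxE => E; rewrite mulmx_trE -[RHS]E.
  by apply: eq_bigr => l _; rewrite !mxE mulrC.
have s0 : 0 < (v *m v^T) 0 0.
  rewrite mulmx_trE lt_neqAle sumr_ge0 ?andbT => [|i _]; last by rewrite -expr2 sqr_ge0.
  rewrite eq_sym; apply: contra v0 => /eqP/psumr_eq0P => v0.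
  apply/eqP/rowP => i; rewrite mxE; apply/eqP; rewrite -sqrf_eq0 expr2 v0 //.
  by move=> j _; rewrite -expr2 sqr_ge0.
set s := (v *m v^T) 0 0 in s0.
pose w := (Num.sqrt s)^-1 *: v.
have ww : (w *m w^T) 0 0 = 1.
  rewrite /w linearZ /= -scalemxAl -scalemxAr scalerA mxE -/s -expr2 exprVn sqr_sqrtr ?ltW //.
  by rewrite mulVf // gt_eqF.
have Cw i : (row i C *m w^T) 0 0 = 0.
  by rewrite /w linearZ /= -scalemxAr mxE vCi mulr0.
have wC i : (w *m (row i C)^T) 0 0 = 0.
  by rewrite -[RHS](Cw i) !mulmx_trE; apply: eq_bigr => l _; rewrite mulrC.
have rowC_hi (i : 'I_d) : (d - k.+1 <= i)%N -> i != j0 -> row i C = f i.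
  by move=> ki /negbTE ij; apply/rowP => l; rewrite !mxE ltnNge ki ij.
have rowC_lo (i : 'I_d) : (i < j0)%N -> row i C = row i B.
  by move=> ij; apply/rowP => l; rewrite !mxE ij mxE.
have gt_j0 (i : 'I_d) : (d - k.+1 <= i)%N -> i != j0 -> (d - k <= i)%N.
  by move=> ki; rewrite -(inj_eq val_inj) /= => ij; lia.
exists (fun i => if i == j0 then w else f i) => [i j ki kj|i j ij kj].
  have [ij|ij] := eqVneq i j0; have [jj|jj] := eqVneq j j0; rewrite ?ij ?jj ?eqxx ?ww //.
  - by rewrite -(rowC_hi j) // wC eq_sym (negbTE jj).
  - by rewrite -(rowC_hi i) // Cw (negbTE ij).
  - by apply: fO; exact: gt_j0.
have [jj|jj] := eqVneq j j0; last by apply: fB => //; exact: gt_j0.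
by rewrite jj in ij; rewrite -rowC_lo ?Cw.
Qed.


(** An infinitesimal motion mu that preserves all distances and fixes b0 is
x |-> (p x - p b0) A on the base, with A skew-symmetric: this is the equation
skew. So mu vanishes on the base when A has no entries above the diagonal, and then
everywhere, since the base is affinely independent. *)
Lemma trivial_motion_pinned (W : finType) (p mu : W -> 'rV[R]_d) b0 (b : 'I_d -> W) :
    let P := \matrix_i (p (b i) - p b0) in let M := \matrix_i (mu (b i) - mu b0) in
  (forall x y, ((p x - p y) *m (mu x - mu y)^T) 0 0 = 0) -> P \in unitmx ->
  mu b0 = 0 -> (forall i j : 'I_d, (i < j)%N -> (invmx P *m M) i j = 0) ->
  forall x, mu x = 0.
Proof.
move=> P M pmu Pu mu0; set A := invmx P *m M => AL.
have ME : M = P *m A by rewrite /A mulKVmx.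
clearbody A.
have skew0 : P *m M^T + M *m P^T = 0.
  apply/matrixP => i j; rewrite !mxE.
  have bil (x y z : W) : ((p x - p z) *m (mu y - mu z)^T) 0 0
      + ((p y - p z) *m (mu x - mu z)^T) 0 0 = 0.
    have sub3 (f : W -> 'rV[R]_d) : f x - f y = (f x - f z) - (f y - f z).
      by rewrite opprB addrA subrK.
    have := pmu x y; have := pmu x z; have := pmu y z; rewrite (sub3 p) (sub3 mu).
    move: (p x - p z) (p y - p z) (mu x - mu z) (mu y - mu z) => a1 a2 m1 m2.
    rewrite linearB /= mulmxBl !mulmxBr => E1 E2; rewrite !mxE in E1 E2 *; lra.
  rewrite -[RHS](bil (b i) (b j) b0) !mulmx_trE.
  by congr (_ + _); apply: eq_bigr => l _; rewrite !mxE // mulrC.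
have skew : A^T = - A.
  apply/eqP; rewrite -addr_eq0; apply/eqP.
  have : P *m (A^T + A) *m P^T = 0.
    by rewrite mulmxDr mulmxDl -[RHS]skew0 ME (trmx_mul P) !mulmxA.
  move/(canRL (mulmxK (_ : P^T \in unitmx))); rewrite unitmx_tr mul0mx => /(_ Pu).
  by move/(canRL (mulKmx Pu)); rewrite mulmx0.
have A0 : A = 0.
  apply/matrixP => i j; rewrite [RHS]mxE; case: (ltngtP i j) => ij; first exact: AL.
    by move/matrixP/(_ j i): skew; rewrite !mxE => ->; rewrite AL ?oppr0.
  have {ij}-> : j = i by apply/val_inj.
  move/matrixP/(_ i i): skew; rewrite !mxE; lra.
have mub i : mu (b i) = 0.
  by move/row_matrixP/(_ i): ME; rewrite A0 mulmx0 rowK row0 mu0 subr0 => ->.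
move=> x; have Px : P *m (mu x)^T = 0.
  apply/matrixP => i j; rewrite ord1 [RHS]mxE.
  have := pmu x (b i); have := pmu x b0; rewrite mub mu0 !subr0 !mulmx_trE => E0 Ei.
  rewrite -[RHS](subrr 0) -[X in X - _]E0 -[X in _ - X]Ei -sumrB mxE.
  by apply: eq_bigr => l _; rewrite !mxE; ring.
by apply/trmx_inj; rewrite -[_^T](mulKmx Pu) Px mulmx0 trmx0.
Qed.

End LinearAlgebra.

(** * Realizations equivalent to a generic one *)

Section Exchange.
Variables (R : realType) (d : nat) (W : finType) (G : sgraph W).
Implicit Types (p q : W -> 'rV[R]_d) (S : seq R).

Definition frame p b0 (b : 'I_d -> W) : 'M[R]_d := \matrix_i (p (b i) - p b0).

(** The points of a generic framework are affinely independent. *)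
Lemma frame_unitmx p b0 b (D : W * 'I_d -> R -> R) S :
  injective b -> (forall i, b i != b0) ->
  dual_family S (fun c => p c.1 0 c.2) [set: W * 'I_d] D -> frame p b0 b \in unitmx.
Proof.
move=> b_inj bb0 [DD _ Dp]; rewrite -row_free_unit.
apply: (@dual_row_free _ _ _ _ (fun i j => D (b i, j))) => // i j k l.
rewrite !mxE (derB (DD _)) (Dp _ (b k, l)) ?inE // (Dp _ (b0, l)) ?inE //.
by rewrite !xpair_eqE (negbTE (bb0 i)) subr0 (inj_eq b_inj).
Qed.

(** The derivations D a dual to p and a further one E killing p are one more than
the coordinates. To each derivation assign its values on the coordinates
of q that are not pinned and, in the places of the pinned ones, the parameters of
the infinitesimal isometry that trivial_motion_pinned uses. By linear_dependence
some nontrivial combination F has all these values zero. Then F kills q, hence the edge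
lengths, hence all distances of p by rig, hence p by trivial_motion_pinned. So the
D a do not occur in F, which is a multiple of E. *)
Lemma pinned_algebraic S p q b0 b (D : W * 'I_d -> R -> R) (E : R -> R) :
  injective b -> (forall i, b i != b0) ->
  dual_family S (fun c => p c.1 0 c.2) [set: W * 'I_d] D ->
  (forall F, derivation F -> kills F S ->
    (forall x y, G x y -> F (sqd (p x) (p y)) = 0) -> forall x y, F (sqd (p x) (p y)) = 0) ->
  (forall x y, G x y -> sqd (p x) (p y) = sqd (q x) (q y)) ->
  q b0 = 0 -> (forall i j : 'I_d, (i < j)%N -> q (b i) 0 j = 0) ->
  derivation E -> kills E S -> (forall x j, E (p x 0 j) = 0) ->
  forall x j, E (q x 0 j) = 0.
Proof.
move=> b_inj bb0 Ddual rig pq q0 qb DE ES Ep.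
have [DD DS Dp] := Ddual; have Pu := frame_unitmx b_inj bb0 Ddual.
set P := frame p b0 b in Pu.
pose D' (o : option (W * 'I_d)) := if o is Some c then D c else E.
have DD' o : derivation (D' o) by case: o.
pose pinned (c : W * 'I_d) := (c.1 == b0) || [exists i, (b i == c.1) && (i < c.2)%N].
pose pin (F : R -> R) (c : W * 'I_d) := if c.1 == b0 then F (p b0 0 c.2) else
  if [pick i | b i == c.1] is Some i then
    \sum_k invmx P i k * (F (p (b k) 0 c.2) - F (p b0 0 c.2)) else 0.
have [|l [o0 lo0] l0] := @linear_dependence R _ _ (fun o c =>
    if pinned c then pin (D' o) c else D' o (q c.1 0 c.2)).
  by rewrite card_option.
pose F x := \sum_o l o * D' o x.
have DF : derivation F by exact: derivation_lincomb.
have FS : kills F S.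
  by move=> x xS; rewrite /F big1 // => -[c|] _ /=; rewrite ?(DS c x xS) ?(ES x xS) mulr0.
have Fpin c : pin F c = \sum_o l o * pin (D' o) c.
  rewrite /pin; case: eqP => // _; case: pickP => [i _|_]; last first.
    by rewrite big1 // => o _; rewrite mulr0.
  under [RHS]eq_bigr => o _ do rewrite mulr_sumr.
  rewrite exchange_big /=; apply: eq_bigr => k _.
  by rewrite /F -sumrB mulr_sumr; apply: eq_bigr => o _; ring.
have Fq x j : F (q x 0 j) = 0.
  case: (boolP (pinned (x, j))) => [|/negbTE np]; last by have := l0 (x, j); rewrite np.
  case/orP=> [/eqP /= ->|/existsP[i /andP[/eqP /= <- ij]]]; first by rewrite q0 mxE (der0 DF).
  by rewrite qb // (der0 DF).
have Fpinned c : pinned c -> pin F c = 0.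
  by move=> cP; rewrite Fpin -[RHS](l0 c) cP.
have Fp : forall x, \row_j F (p x 0 j) = 0 :> 'rV_d.
  apply: (trivial_motion_pinned (p := p) (b0 := b0) (b := b)) Pu _ _.
  - move=> x y; have : F (sqd (p x) (p y)) = 0.
      apply: (rig F DF FS) => {}x {}y xy; rewrite pq // (der_sqd _ _ DF) big1 ?mul0rn // => j _.
      by rewrite !Fq subrr mulr0.
    rewrite (der_sqd _ _ DF) => /eqP; rewrite mulrn_eq0 /= => /eqP E0.
    by rewrite mulmx_trE -[RHS]E0; apply: eq_bigr => j _; rewrite !mxE.
  - apply/rowP => j; rewrite !mxE.
    by have := Fpinned (b0, j); rewrite /pinned /pin /= eqxx => /(_ isT).
  - move=> i j ij; have := Fpinned (b i, j); rewrite /pinned /pin /= (negbTE (bb0 i)) /=.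
    have -> : [exists k, (b k == b i) && (k < j)%N] by apply/existsP; exists i; rewrite eqxx.
    case: pickP => [k /eqP/b_inj ->|/(_ i)]; last by rewrite eqxx.
    move=> /(_ isT) E0; rewrite -[RHS]E0 mxE; apply: eq_bigr => m _; rewrite !mxE //.
have lsome c : l (Some c) = 0.
  have /rowP/(_ c.2) := Fp c.1; rewrite !mxE /F (bigD1 (Some c)) //=.
  rewrite (Dp c (c.1, c.2)) ?inE // -surjective_pairing eqxx mulr1 big1 ?addr0 //.
  move=> [c'|] /= cc; last by rewrite Ep mulr0.
  rewrite (Dp c' (c.1, c.2)) ?inE // -surjective_pairing.
  by rewrite (_ : c' == c = false) ?mulr0 //; apply/negbTE; apply: contra cc => /eqP ->.
have lnone : l None != 0 by case: o0 lo0 => // c; rewrite lsome eqxx.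
move=> x j; apply: (mulfI lnone); rewrite mulr0 -[RHS](Fq x j) /F (bigD1 None) //=.
by rewrite big1 ?addr0 // => -[c|] // _; rewrite lsome mul0r.
Qed.

(** Write M for the matrix of derivatives of the coordinates of c'. Applying D i to the
distance equations gives c - p x = (c' - q x) M for all x in N. Applying
D k once more, and taking differences in x, shows that M is killed by D k, and then
that the transpose of M times M is the identity. So M is the linear part of a congruence. *)
Lemma generic_distances_congruent p q (N : W -> Prop) (c c' : 'rV[R]_d) b0 b (D : 'I_d -> R -> R) :
  (forall i, derivation (D i)) -> (forall i j, D i (c 0 j) = (i == j)%:R) ->
  (forall i x j, D i (p x 0 j) = 0) -> (forall i x j, D i (q x 0 j) = 0) ->
  N b0 -> (forall i, N (b i)) -> frame p b0 b \in unitmx ->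
  (forall x, N x -> sqd c (p x) = sqd c' (q x)) ->
  forall x y, N x -> N y -> sqd (p x) (p y) = sqd (q x) (q y).
Proof.
move=> DD Dc Dp Dq Nb0 Nb Pu cN.
pose M := \matrix_(j, i) D i (c' 0 j).
have key1 x : N x -> c - p x = (c' - q x) *m M.
  move=> Nx; apply/rowP => i; have := congr1 (D i) (cN x Nx).
  rewrite !(der_sqd _ _ (DD i)) => /eqP; rewrite eqr_pMn2r // => /eqP.
  rewrite (bigD1 i) //= Dc eqxx Dp subr0 mulr1 big1 ?addr0 => [E|j ji]; last first.
    by rewrite Dc Dp eq_sym (negbTE ji) subrr mulr0.
  by rewrite !mxE E; apply: eq_bigr => j _; rewrite !mxE Dq subr0.
pose M' k := map_mx (D k) M.
have key2 k x : N x -> (c' - q x) *m M' k = row k (1%:M - M^T *m M).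
  move=> Nx; apply/rowP => i; have /rowP/(_ i)/(congr1 (D k)) := key1 x Nx.
  rewrite mxE [in X in _ = X -> _]mxE mxE (derB (DD k)) Dc Dp subr0 (der_sum (DD k)).
  under eq_bigr => j _ do rewrite (derM (DD k)) !mxE (derB (DD k)) Dq subr0.
  rewrite big_split /= => E.
  have -> : row k (1%:M - M^T *m M) 0 i = (k == i)%:R - (M^T *m M) k i by rewrite !mxE.
  have -> : (M^T *m M) k i = \sum_j (D k (c' 0 j)) * D i (c' 0 j).
    by rewrite mxE; apply: eq_bigr => j _; rewrite !mxE.
  by rewrite E addrK mxE; apply: eq_bigr => j _; rewrite !mxE.
have sub_key1 x y : N x -> N y -> p x - p y = (q x - q y) *m M.
  move=> Nx Ny; have -> : p x - p y = (c - p y) - (c - p x) by rewrite opprB [RHS]addrC subrKA.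
  by rewrite !key1 // -mulmxBl opprB [X in X *m _]addrC subrKA.
have Q_M : frame p b0 b = frame q b0 b *m M.
  by apply/row_matrixP => i; rewrite row_mul !rowK sub_key1.
have Qu : frame q b0 b \in unitmx by move: Pu; rewrite Q_M unitmx_mul => /andP[].
have M'0 k : M' k = 0.
  apply: (can_inj (mulKmx Qu)); rewrite mulmx0; apply/row_matrixP => i.
  rewrite row_mul rowK row0 (_ : q (b i) - q b0 = (c' - q b0) - (c' - q (b i))).
    by rewrite mulmxBl !key2 // subrr.
  by rewrite opprB [RHS]addrC subrKA.
have MM : M^T *m M = 1%:M.
  apply/row_matrixP => k; apply/eqP; rewrite eq_sym -subr_eq0 -linearB /=.
  by rewrite -(key2 k b0) // M'0 mulmx0.
by move=> x y Nx Ny; apply: (sqd_orthogonal (mulmx1C MM)); exact: sub_key1.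
Qed.

End Exchange.

(** * Limits of frameworks *)

Section Limits.
Local Open Scope classical_set_scope.
Variable R : realType.

Lemma cvg_reindex (u : nat -> R) (l : R) (phi : nat -> nat) : (forall n, n <= phi n)%N ->
  u n @[n --> \oo] --> l -> u (phi n) @[n --> \oo] --> l.
Proof.
move=> le_phi; apply: cvg_comp => A [N _ NA]; exists N => // n /= Nn; apply: NA => /=.
exact: leq_trans (le_phi n).
Qed.

(** Successive extraction of subsequences, one index at a time. *)
Lemma bolzano_weierstrass_family (I : finType) (f : nat -> I -> R) (B : I -> R) :
  (forall n i, `|f n i| <= B i) ->
  exists (phi : nat -> nat) (g : I -> R), (forall n, n <= phi n)%N /\
    forall i, f (phi n) i @[n --> \oo] --> g i.
Proof.
move=> fB; suff [phi [g [phi_ge cvg_f]]] : exists (phi : nat -> nat) (g : I -> R),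
    (forall n, n <= phi n)%N /\ {in enum I, forall i, f (phi n) i @[n --> \oo] --> g i}.
  by exists phi, g; split=> // i; apply: cvg_f; rewrite mem_enum.
elim: (enum I) => [|i s [phi [g [phi_ge IH]]]]; first by exists id, (fun=> 0).
have [|psi psi_inc /cvg_ex[l psi_l]] := @bolzano_weierstrass R (fun n => f (phi n) i).
  exists (B i); split; first exact: num_real.
  by move=> M /ltW BM n _ /=; apply: le_trans BM.
have psi_ge n : (n <= psi n)%N.
  elim: n => // n IHn; apply: leq_ltn_trans IHn _.
  by rewrite ltnNge -leEnat psi_inc ltnn.
exists (phi \o psi), (fun j => if j == i then l else g j); split.
  by move=> n /=; apply: leq_trans (phi_ge _); exact: psi_ge.
move=> j; rewrite inE; have [-> _|_ /= js] := eqVneq j i; first exact: psi_l.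
exact: (cvg_reindex psi_ge (IH j js)).
Qed.

Lemma cvg_sqd d (a b : nat -> 'rV[R]_d) (la lb : 'rV[R]_d) :
  (forall j, a n 0 j @[n --> \oo] --> la 0 j) ->
  (forall j, b n 0 j @[n --> \oo] --> lb 0 j) ->
  sqd (a n) (b n) @[n --> \oo] --> sqd la lb.
Proof.
move=> cva cvb; apply: cvg_big => [|j _]; first exact: add_continuous.
rewrite expr2; under eq_fun do rewrite expr2.
by apply: cvgM; apply: cvgB.
Qed.

Lemma cvg_inv_succ (u : nat -> R) (l : R) : (forall n, `|u n - l| < n.+1%:R^-1) ->
  u n @[n --> \oo] --> l.
Proof.
move=> ul; apply/cvgrPdist_lt => e e0.
have := @cvg_harmonic R; move/cvgrPdist_lt => /(_ e e0)[N _ NP].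
exists N => // n /= Nn; rewrite distrC; apply: lt_trans (ul n) _.
have := NP n Nn; rewrite sub0r normrN /= ger0_norm ?invr_ge0 //.
Qed.

Lemma cvg_lim_unique (u v : nat -> R) (l l' : R) : (forall n, u n = v n) ->
  u n @[n --> \oo] --> l -> v n @[n --> \oo] --> l' -> l = l'.
Proof.
by move=> /funext -> h h'; apply: (@cvg_unique _ (@norm_hausdorff R _)) h h'.
Qed.

End Limits.

(** * Congruences, components and small rigid graphs *)

Section Isometries.
Variables (R : realType) (d : nat) (W : finType).

Lemma inner_sqd (a b c : 'rV[R]_d) :
  ((a - c) *m (b - c)^T) 0 0 *+ 2 = sqd a c + sqd b c - sqd a b.
Proof.
rewrite mulmx_trE /sqd -big_split -sumrB -sumrMnl; apply: eq_bigr => j _.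
by rewrite !mxE /=; ring.
Qed.

Lemma mulmx_frame_tr (p : W -> 'rV[R]_d) b0 b (u : 'rV[R]_d) i :
  (u *m (frame p b0 b)^T) 0 i = (u *m (p (b i) - p b0)^T) 0 0.
Proof. by rewrite mulmx_trE mxE; apply: eq_bigr => j _; rewrite !mxE. Qed.

(** Equal distances give equal Gram matrices, so that the quotient of the two
frames is orthogonal. *)
Lemma congruent_isometry (p q : W -> 'rV[R]_d) b0 b : frame p b0 b \in unitmx ->
  (forall x y, sqd (p x) (p y) = sqd (q x) (q y)) ->
  exists2 M : 'M[R]_d, M *m M^T = 1%:M & forall x, p x - p b0 = (q x - q b0) *m M.
Proof.
move=> Pu pq; set P := frame p b0 b in Pu; pose Q := frame q b0 b.
have inner x y : ((p x - p b0) *m (p y - p b0)^T) 0 0 = ((q x - q b0) *m (q y - q b0)^T) 0 0.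
  by apply/eqP; rewrite -(eqr_pMn2r (n := 2)) // !inner_sqd !pq.
have gram x : (p x - p b0) *m P^T = (q x - q b0) *m Q^T.
  by apply/rowP => i; rewrite !mulmx_frame_tr inner.
have PQ : P *m P^T = Q *m Q^T.
  by apply/row_matrixP => i; rewrite !row_mul !rowK gram.
have Qu : Q \in unitmx.
  have : P *m P^T \in unitmx by rewrite unitmx_mul unitmx_tr Pu.
  by rewrite PQ unitmx_mul => /andP[].
have Qtu : Q^T \in unitmx by rewrite unitmx_tr.
have Ptu : P^T \in unitmx by rewrite unitmx_tr.
exists (invmx Q *m P).
  by rewrite trmx_mul trmx_inv mulmxA -(mulmxA _ P) PQ mulmxA mulVmx // mul1mx mulmxV.
move=> x; apply: (can_inj (mulmxK Ptu)).
by rewrite gram -!mulmxA PQ mulKmx.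
Qed.

End Isometries.

Section Components.
Variables (V : finType) (G : sgraph V) (V0 : {set V}).
Local Notation U := {x | x \in ~: V0}.
Local Notation H := (delete_vertices G V0).

Lemma connect_graph_sym (T : finType) (K : sgraph T) : connect_sym K.
Proof. by apply: sym_connect_sym; exact: edge_sym. Qed.

Definition attachments (w : U) : {set {x | x \in V0}} :=
  [set x | [exists w' : U, connect H w w' && G (val x) (val w')]].

(** If there were at most d attachments, deleting them would separate w from the
rest of V0. *)
Lemma card_attachments d (w : U) :
  k_connected d.+1 G -> (d < #|V0|)%N -> (d < #|attachments w|)%N.
Proof.
move=> [_ Gconn] V0d; rewrite -(card_imset _ val_inj) ltnNge; apply/negP => Nd.
set N := val @: attachments w in Nd; have [_ conn] := Gconn N Nd.
have NV0 z : z \in N -> z \in V0 by case/imsetP => x _ ->; exact: valP.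
have wN : val w \in ~: N by have := valP w; rewrite !inE; apply: contra; exact: NV0.
have [x xV0 xN] : exists2 x, x \in V0 & x \notin N.
  apply/subsetPn; apply: contraTN V0d => /subset_leq_card V0N.
  by rewrite -leqNgt (leq_trans V0N).
have xN' : x \in ~: N by rewrite inE.
pose a := [pred y : {x | x \in ~: N} | [exists w' : U, connect H w w' && (val y == val w')]].
have a_closed : fingraph.closed (delete_vertices G N) a.
  apply: intro_closed; first exact: connect_graph_sym.
  move=> y z yz /existsP[w' /andP[ww' /eqP yw']]; apply/existsP.
  have yz' : G (val y) (val z) by [].
  have [zV0|zV0] := boolP (val z \in V0).
    have := valP z; rewrite !inE => /negP[]; apply/imsetP; exists (Sub (val z) zV0) => //.
    by rewrite inE; apply/existsP; exists w'; rewrite ww' edge_sym SubK -yw'.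
  have zU : val z \in ~: V0 by rewrite inE.
  exists (Sub (val z) zU); rewrite SubK eqxx andbT (connect_trans ww') // connect1 //.
  by rewrite /= /induced_edge SubK -yw'.
have := closed_connect a_closed (conn (Sub (val w) wN) (Sub x xN')).
have -> : (Sub (val w) wN : {x | x \in ~: N}) \in a.
  by apply/existsP; exists w; rewrite connect0 SubK eqxx.
move/esym/existsP => [w' /andP[_ /eqP xw']]; have := valP w'.
by rewrite -xw' SubK inE xV0.
Qed.

Lemma clique_equivalent (R : realType) d (p q : {x | x \in V0} -> 'rV[R]_d) :
  (forall x y : {x | x \in V0}, G (val x) (val y) -> sqd (p x) (p y) = sqd (q x) (q y)) ->
  (forall w, {in attachments w &, forall x y, sqd (p x) (p y) = sqd (q x) (q y)}) ->
  equivalent (Clique G V0) p q.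
Proof.
move=> pqG pqN x y xy; apply/enormB_eq; case/orP: xy => [/pqG //|/andP[_ /existsP[C]]].
case/and3P=> /imsetP[w _ ->] xC yC.
have att (z : {x | x \in V0}) : val z \in neighbours G (val @: [set y in [set: U] | connect H w y]) ->
    z \in attachments w.
  rewrite !inE => /andP[_ /existsP[_ /andP[/imsetP[w' + ->] w'z]]].
  by rewrite !inE /= => ww'; apply/existsP; exists w'; rewrite ww' edge_sym; exact: w'z.
exact: (pqN w x y (att x xC) (att y yC)).
Qed.

Lemma exists_base (T : finType) (A : {set T}) d : (d < #|A|)%N ->
  exists (b0 : T) (b : 'I_d -> T),
    [/\ injective b, forall i, b i != b0, b0 \in A & forall i, b i \in A].
Proof.
move=> dA; have A0 : (0 < #|A|)%N by exact: leq_trans dA.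
have Ai (i : 'I_d) : (i.+1 < #|A|)%N by apply: leq_ltn_trans dA.
exists (enum_val (Ordinal A0)), (fun i => enum_val (Ordinal (Ai i))); split.
- by move=> i j /enum_val_inj[] /val_inj.
- by move=> i; rewrite (inj_eq enum_val_inj).
- exact: enum_valP.
- by move=> i; exact: enum_valP.
Qed.

End Components.

Section SmallRigidGraphs.
Variables (R : realType) (d : nat) (W : finType) (G : sgraph W).

(** With at most d+1 vertices, the points of a generic framework are affinely
independent, so that for a non-edge {x,y} one can move x infinitesimally, keeping
its distances to all vertices but y. A derivation with these values on p kills the edge
lengths and not the distance from x to y, against rigidity_constants. *)
Lemma small_rigid_complete : (#|W| <= d.+1)%N -> rigid R d G ->
  forall x y : W, x != y -> G x y.
Proof.
move=> Wd rig x y xy; have [k kP] := rigidity_constants R d G.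
have [|z [D [_ _ Ddual]]] := @dual_family_extend R (W * 'I_d)%type k (fun=> 0) finset.set0
  (fun _ _ => 0) 1 ltr01.
  by split=> [i|//|i j]; [exact: derivation0 | rewrite inE].
pose p w : 'rV[R]_d := \row_j z (w, j).
have {}Ddual : dual_family k (fun c => p c.1 0 c.2) [set: W * 'I_d] D.
  by case: Ddual => DD DS Dz; split=> // i [c j] ci cj; rewrite mxE Dz.
have p_rig := rig p (dual_generic Ddual); have [DD Dk Dp] := Ddual.
pose A := [set~ x]; pose P : 'M[R]_(#|A|, d) := \matrix_i (p (enum_val i) - p x).
have Pfree : row_free P.
  apply: (@dual_row_free _ _ _ _ (fun i j => D (enum_val i, j))) => // [|i j m l].
    by move: Wd; rewrite cardsC1; case: #|W|.
  have -> : P m l = p (enum_val m) 0 l - p x 0 l by rewrite !mxE.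
  rewrite (derB (DD _)) (Dp _ (enum_val m, l)) ?inE // (Dp _ (x, l)) ?inE //.
  rewrite !xpair_eqE (inj_eq enum_val_inj).
  by have := enum_valP i; rewrite !inE => /negbTE ->; rewrite subr0.
have [B PB] := row_freeP Pfree.
have yA : y \in A by rewrite !inE eq_sym.
(* The column y of a right inverse of P is a vector orthogonal to all p w - p x
   with w distinct from x and y, but not to p y - p x. *)
pose iy := enum_rank_in yA y; pose mu j := B j iy.
pose F a := \sum_j mu j * D (x, j) a.
have DF : derivation F by apply: derivation_lincomb.
have Fk : kills F k by move=> a ak; rewrite /F big1 // => j _; rewrite (Dk (x, j)) ?mulr0.
have Fp w l : F (p w 0 l) = if w == x then mu l else 0.
  rewrite /F (bigD1 l) //= (Dp (x, l) (w, l)) ?inE // xpair_eqE eqxx andbT big1 => [|j jl].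
    by rewrite addr0 eq_sym; case: eqP; rewrite ?mulr1 ?mulr0.
  by rewrite (Dp (x, j) (w, l)) ?inE // xpair_eqE (negbTE jl) andbF mulr0.
have Fx w : w != x -> F (sqd (p x) (p w)) = - ((w == y)%:R *+ 2).
  move=> wx; rewrite (der_sqd _ _ DF) -mulNrn; congr (_ *+ 2).
  have wA : w \in A by rewrite !inE.
  move/matrixP/(_ (enum_rank_in wA w) iy): PB; rewrite !mxE.
  have -> : (enum_rank_in wA w == iy) = (w == y).
    apply/eqP/eqP => [E|E]; last by apply: enum_val_inj; rewrite !enum_rankK_in.
    by rewrite -(enum_rankK_in wA wA) E enum_rankK_in.
  move=> <-; rewrite -sumrN; apply: eq_bigr => j _.
  by rewrite !Fp eqxx (negbTE wx) !mxE enum_rankK_in // subr0 -mulNr opprB.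
apply: contraT => Gxy; have Fedge a b : G a b -> F (sqd (p a) (p b)) = 0.
  have [->|ax] := eqVneq a x; have [->|bx] := eqVneq b x => ab.
  - by rewrite edge_irr in ab.
  - rewrite Fx //; case: eqP ab => [-> xy'|_ _]; first by rewrite xy' in Gxy.
    by rewrite mul0rn oppr0.
  - rewrite sqdC Fx //; case: eqP ab => [-> xy'|_ _]; last by rewrite mul0rn oppr0.
    by rewrite edge_sym xy' in Gxy.
  - rewrite (der_sqd _ _ DF) big1 ?mul0rn // => j _.
    by rewrite !Fp (negbTE ax) (negbTE bx) subrr mulr0.
have := kP p p_rig F DF Fk Fedge x y.
by rewrite Fx 1?eq_sym // eqxx => /eqP; rewrite oppr_eq0 pnatr_eq0.
Qed.

End SmallRigidGraphs.

(** * The contracted framework and its approximations *)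

Section Contraction.
Variables (R : realType) (d : nat) (V : finType) (G : sgraph V) (V0 : {set V}).
Local Notation W := {x | x \in V0}.
Local Notation U := {x | x \in ~: V0}.
Local Notation H := (delete_vertices G V0).
Local Notation hub w := (fingraph.root H w).

(** A component of G - V0 is represented by the hub of its vertices, so the contracted
points are given by a function on all vertices outside V0. *)
Definition contracted_coords (p : W -> 'rV[R]_d) (c : U -> 'rV[R]_d)
    (i : (W * 'I_d) + (U * 'I_d)) : R :=
  match i with inl a => p a.1 0 a.2 | inr a => c a.1 0 a.2 end.

(** After an isometry q is triangular, and pinned_algebraic shows that the
derivations dual to the hubs kill it; then generic_distances_congruent applies to every
component. *)
Lemma contracted_congruent S p c D :
  k_connected d.+1 G -> (d < #|V0|)%N ->
  (forall F, derivation F -> kills F S ->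
    (forall x y, induced_subgraph G V0 x y -> F (sqd (p x) (p y)) = 0) ->
    forall x y, F (sqd (p x) (p y)) = 0) ->
  dual_family S (contracted_coords p c) [set: (W * 'I_d) + (U * 'I_d)] D ->
  globally_rigid R d (Clique G V0) ->
  forall (q : W -> 'rV[R]_d) (c' : U -> 'rV[R]_d),
  (forall x y, induced_subgraph G V0 x y -> sqd (p x) (p y) = sqd (q x) (q y)) ->
  (forall (w : U) (x : W), G (val x) (val w) ->
     sqd (c (hub w)) (p x) = sqd (c' (hub w)) (q x)) ->
  forall x y, sqd (p x) (p y) = sqd (q x) (q y).
Proof.
move=> Gconn V0d rig [DD DS Dpc] grig q c' pq pc x y.
have Dp : dual_family S (fun a => p a.1 0 a.2) [set: W * 'I_d] (fun a => D (inl a)).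
  by split=> // a b _ _; rewrite (Dpc (inl a) (inl b)) ?inE.
have [|b0 [b [b_inj bb0 _ _]]] := @exists_base W [set: W] d.
  by rewrite cardsT card_sig.
have [O OO qO] := orthogonal_triangulation (frame q b0 b).
pose q' z := (q z - q b0) *m O^T; pose c'' w := (c' w - q b0) *m O^T.
have OtO : O^T *m O^T^T = 1%:M by rewrite trmxK (mulmx1C OO).
have qq' z z' : sqd (q' z) (q' z') = sqd (q z) (q z').
  by apply: (sqd_orthogonal OtO); rewrite -mulmxBl opprB addrA subrK.
have cq' w z : sqd (c'' w) (q' z) = sqd (c' w) (q z).
  by apply: (sqd_orthogonal OtO); rewrite -mulmxBl opprB addrA subrK.
have Dq' a z j : D (inr a) (q' z 0 j) = 0.
  move: z j; apply: (pinned_algebraic b_inj bb0 Dp rig) => //.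
  - by move=> z z' zz'; rewrite qq' pq.
  - by rewrite /q' subrr mul0mx.
  - move=> i j ij; rewrite -[RHS](qO i j ij) !mxE.
    by apply: eq_bigr => l _; rewrite !mxE.
  - by move=> z j; rewrite (Dpc (inr a) (inl (z, j))) ?inE.
suff /grig : equivalent (Clique G V0) p q.
  by move=> /(_ (dual_generic Dp)) /(_ x y) /enormB_eq.
apply: clique_equivalent => [z z' zz'|w z z' zw zw']; first exact: pq.
have [b1 [e [e_inj eb1 b1w ew]]] := exists_base (card_attachments w Gconn V0d).
rewrite -[RHS]qq'.
apply: (@generic_distances_congruent R d _ p q' (fun z => z \in attachments G w)
  (c (hub w)) (c'' (hub w)) b1 e (fun i => D (inr (hub w, i)))) => //.
- move=> i j; rewrite (Dpc (inr _) (inr (hub w, j))) ?inE //.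
  by rewrite -[inr _ == _]/((hub w, i) == (hub w, j)) xpair_eqE eqxx.
- by move=> i t j; rewrite (Dpc (inr _) (inl (t, j))) ?inE.
- exact: frame_unitmx e_inj eb1 Dp.
- move=> t; rewrite inE => /existsP[w' /andP[ww' tw']].
  have Hsym := connect_graph_sym H.
  by rewrite cq' (fingraph.rootP Hsym ww') pc.
Qed.

End Contraction.

Section Bounded.
Variables (R : realType) (d : nat) (V : finType) (G : sgraph V).

Lemma k_connected_connect k : k_connected k.+1 G -> forall x y : V, connect G x y.
Proof.
move=> [_ /(_ finset.set0)[|_ conn x y]]; first by rewrite cards0.
have out z : z \in ~: (finset.set0 : {set V}) by rewrite !inE.
pose a := [pred z : {x | x \in ~: (finset.set0 : {set V})} | connect G x (val z)].
have a_closed : fingraph.closed (delete_vertices G finset.set0) a.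
  apply: intro_closed; first exact: connect_graph_sym.
  by move=> z t zt xz; apply: connect_trans xz (connect1 _).
have := closed_connect a_closed (conn (Sub x (out x)) (Sub y (out y))).
by rewrite !inE /= connect0.
Qed.

(** Boundedness propagates from u along edges, whose lengths are bounded. *)
Lemma equivalent_bounded u (p q : nat -> V -> 'rV[R]_d) (C : V -> R) :
  (forall y, connect G u y) -> (forall n y j, `|p n y 0 j| <= C y) ->
  (forall n, q n u = 0) ->
  (forall n x y, G x y -> sqd (p n x) (p n y) = sqd (q n x) (q n y)) ->
  exists B : V -> R, forall n y j, `|q n y 0 j| <= B y.
Proof.
move=> conn pC qu pq; pose a := [pred y | `[< exists B, forall n j, `|q n y 0 j| <= B >]].
suff aT y : exists B, forall n j, `|q n y 0 j| <= B.
  by have [B HB] := choice aT; exists B => n y j; apply: HB.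
have a_closed : fingraph.closed G a.
  apply: intro_closed; first exact: connect_graph_sym.
  move=> x z xz /asboolP[B HB]; apply/asboolP.
  pose E := \sum_(j < d) (C x + C z) ^+ 2.
  exists (B + (1 + E)) => n j.
  have le_E : (q n x 0 j - q n z 0 j) ^+ 2 <= E.
    apply: (@le_trans _ _ (sqd (q n x) (q n z))).
      by rewrite /sqd (bigD1 j) //= lerDl sumr_ge0 // => i _; exact: sqr_ge0.
    rewrite -pq //; apply: ler_sum => i _; rewrite -real_normK ?num_real //.
    rewrite ler_pXn2r ?nnegrE ?normr_ge0 //.
      by apply: le_trans (ler_normB _ _) _; apply: lerD.
    by apply: addr_ge0; apply: le_trans (normr_ge0 _) (pC n _ i).
  rewrite -[q n z 0 j](subKr (q n x 0 j)); apply: le_trans (ler_normB _ _) _.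
  apply: lerD (HB n j) _; apply: le_trans (_ : 1 + (q n x 0 j - q n z 0 j) ^+ 2 <= _).
    move: (q n x 0 j - q n z 0 j) => t; rewrite ler_norml; nra.
  by rewrite lerD2l.
have := closed_connect a_closed (conn y).
have -> : u \in a by apply/asboolP; exists 0 => n j; rewrite qu mxE normr0.
by move/esym/asboolP.
Qed.

End Bounded.

Section Main.
Variables (R : realType) (d : nat) (V : finType) (G : sgraph V) (V0 : {set V}).
Local Notation W := {x | x \in V0}.
Local Notation U := {x | x \in ~: V0}.
Local Notation H := (delete_vertices G V0).
Local Notation hub w := (fingraph.root H w).

(** The limit position of the vertices of G, every component of G - V0 being collapsed
to the point of its hub. *)
Definition clustered (p : W -> 'rV[R]_d) (c : U -> 'rV[R]_d) (z : V) : 'rV[R]_d :=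
  if insub z is Some x then p x else if insub z is Some w then c (hub w) else 0.

Lemma clustered_in p c (x : W) : clustered p c (val x) = p x.
Proof. by rewrite /clustered valK. Qed.

Lemma clustered_out p c (w : U) : clustered p c (val w) = c (hub w).
Proof.
by rewrite /clustered insubN ?valK //; have := valP w; rewrite inE.
Qed.

(** The coordinates on V0 are already algebraically independent, and the others can be
chosen near any target. *)
Lemma generic_near_clustered S (p : W -> 'rV[R]_d) (c : U -> 'rV[R]_d)
    (D : W * 'I_d -> R -> R) (eps : R) : 0 < eps ->
  dual_family S (fun a => p a.1 0 a.2) [set: W * 'I_d] D ->
  exists p' : V -> 'rV[R]_d, [/\ generic p', forall x : W, p' (val x) = p x
    & forall z j, `|p' z 0 j - clustered p c z 0 j| < eps].
Proof.
move=> eps0 [DD DS Dp].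
pose x0 (a : V * 'I_d) := clustered p c a.1 0 a.2.
pose A := [set a : V * 'I_d | a.1 \in V0].
pose D0 (a : V * 'I_d) := if insub a.1 is Some x then D (x, a.2) else fun=> 0.
have inA (a : V * 'I_d) : a \in A -> exists2 x : W, insub a.1 = Some x & a = (val x, a.2).
  rewrite inE => a0; exists (Sub a.1 a0); first by rewrite insubT.
  by rewrite SubK -surjective_pairing.
have [|x [E [xA xx0 Ex]]] := @dual_family_extend R (V * 'I_d)%type S x0 A D0 eps eps0.
  split=> [a|a|a b /inA[y ya ->] /inA[z zb ->]].
  - by rewrite /D0; case: insub => [z|]; [exact: DD | exact: derivation0].
  - by rewrite /D0; case: insub => [z|//]; exact: DS.
  - by rewrite /D0 /x0 /= valK clustered_in (Dp (y, _) (z, b.2)) ?inE //.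
exists (fun z => \row_j x (z, j)); split.
- apply: (@dual_generic R V d _ S E); case: Ex => DE ES Ex; split=> // a [z j] aT zT.
  by rewrite mxE Ex.
- by move=> y; apply/rowP => j; rewrite mxE xA ?inE /= ?(valP y) // /x0 /= clustered_in.
- by move=> z j; rewrite mxE; exact: xx0 (z, j).
Qed.

End Main.

Section LimitFrameworks.
Local Open Scope classical_set_scope.
Variables (R : realType) (d : nat) (V : finType) (G : sgraph V).

(** The frameworks q n are bounded, so a subsequence converges, and squared distances
are continuous. *)
Lemma equivalent_limit u (ps : V -> 'rV[R]_d) (p q : nat -> V -> 'rV[R]_d) :
  (forall y, connect G u y) ->
  (forall n y j, `|p n y 0 j - ps y 0 j| < n.+1%:R^-1) ->
  (forall n, q n u = 0) ->
  (forall n x y, G x y -> sqd (p n x) (p n y) = sqd (q n x) (q n y)) ->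
  exists (phi : nat -> nat) (qs : V -> 'rV[R]_d),
    (forall y j, q (phi n) y 0 j @[n --> \oo] --> qs y 0 j) /\
    forall x y, G x y -> sqd (ps x) (ps y) = sqd (qs x) (qs y).
Proof.
move=> conn p_ps qu pq.
have pC n y j : `|p n y 0 j| <= \sum_j `|ps y 0 j| + 1.
  rewrite -(subrK (ps y 0 j) (p n y 0 j)) addrC; apply: le_trans (ler_normD _ _) _.
  apply: lerD; first by rewrite (bigD1 j) //= lerDl sumr_ge0.
  by apply: ltW; apply: lt_le_trans (p_ps n y j) _; rewrite invf_le1 ?ltr0n // ler1n.
have [B qB] := equivalent_bounded conn pC qu pq.
have [phi [g [phi_ge cvg_q]]] := @bolzano_weierstrass_family R (V * 'I_d)%type
  (fun n a => q n a.1 0 a.2) (fun a => B a.1) (fun n a => qB n a.1 a.2).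
pose qs y : 'rV[R]_d := \row_j g (y, j).
have cvg_qs y j : q (phi n) y 0 j @[n --> \oo] --> qs y 0 j.
  by rewrite mxE; exact: cvg_q (y, j).
have cvg_ps y j : p (phi n) y 0 j @[n --> \oo] --> ps y 0 j.
  apply: (@cvg_reindex R (fun n => p n y 0 j)) phi_ge _.
  exact: cvg_inv_succ (fun n => p_ps n y j).
exists phi, qs; split=> // x y xy.
apply: (cvg_lim_unique (u := fun n => sqd (p (phi n) x) (p (phi n) y))
  (v := fun n => sqd (q (phi n) x) (q (phi n) y))).
- by move=> n; exact: pq.
- exact: cvg_sqd.
- exact: cvg_sqd.
Qed.

(** The isometry that takes the limit qs to p takes q n close to p for large n, where
rigidity of p applies. *)
Lemma rigid_limit_congruent (p : V -> 'rV[R]_d) (q : nat -> V -> 'rV[R]_d)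
    (qs : V -> 'rV[R]_d) b0 b :
  rigid_framework G p -> frame p b0 b \in unitmx ->
  (forall y j, q n y 0 j @[n --> \oo] --> qs y 0 j) ->
  (forall n x y, G x y -> sqd (p x) (p y) = sqd (q n x) (q n y)) ->
  (forall x y, sqd (p x) (p y) = sqd (qs x) (qs y)) ->
  exists n, forall x y, sqd (p x) (p y) = sqd (q n x) (q n y).
Proof.
move=> [eps eps0 rig] Pu cvg_q pq pqs.
have [M MM pM] := congruent_isometry Pu pqs.
have near_qs y : \forall n \near \oo, sqd (qs y) (q n y) < eps ^+ 2.
  have cvg_s : sqd (qs y) (q n y) @[n --> \oo] --> sqd (qs y) (qs y).
    by apply: cvg_sqd => // j; exact: cvg_cst.
  have s0 : sqd (qs y) (qs y) = 0 by rewrite /sqd big1 // => j _; rewrite subrr expr0n.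
  rewrite s0 in cvg_s; have := cvgr_lt _ cvg_s; apply.
  by rewrite exprn_gt0.
have [N _ NP] := filter_forall _ near_qs; exists N => x y.
have {}NP z : sqd (qs z) (q N z) < eps ^+ 2 by exact: NP N (leqnn N) z.
pose g z := (q N z - qs b0) *m M + p b0.
have gq z t : sqd (g z) (g t) = sqd (q N z) (q N t).
  apply: (sqd_orthogonal MM); rewrite /g opprD addrACA subrr addr0 -mulmxBl.
  by rewrite opprB addrA subrK.
have pg z : sqd (p z) (g z) = sqd (qs z) (q N z).
  apply: (sqd_orthogonal MM); rewrite -(subrK (p b0) (p z)) pM /g opprD addrACA subrr addr0.
  by rewrite -mulmxBl opprB addrA subrK.
rewrite -gq; apply/enormB_eq; apply: rig => [z t zt|z].
  by apply/enormB_eq; rewrite gq; exact: pq.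
by rewrite enormBE pg -(gtr0_norm eps0) -sqrtr_sqr ltr_sqrt ?exprn_gt0.
Qed.

End LimitFrameworks.

Theorem theorem4p5 (R : realType) (d : nat) (V : finType) (G : sgraph V)
    (u v : V) (V0 : {set V}) :
  (1 <= d)%N ->
  k_connected d.+1 G ->
  uv_rigid R d G V0 u v ->
  globally_rigid R d (Clique G V0) ->
  weakly_globally_linked R d G u v.
Proof.
move=> _ Gconn [rig uV0 vV0] grig.
pose W := {x | x \in V0}; pose U := {x | x \in ~: V0}.
pose uW : W := Sub u uV0; pose vW : W := Sub v vV0.
have dual0 (I : finType) S (x0 : I -> R) : dual_family S x0 finset.set0 (fun _ _ => 0).
  by split=> [i|//|i j]; [exact: derivation0 | rewrite inE].
have [V0d|V0d] := leqP #|V0| d.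
  have [x [D [_ _ Dx]]] := dual_family_extend ltr01 (dual0 (V * 'I_d)%type [::] (fun=> 0)).
  exists (fun z => \row_j x (z, j)).
    apply: (@dual_generic R V d _ [::] D); case: Dx => DD DS Dx; split=> // a [z j] aT zT.
    by rewrite mxE Dx.
  move=> q pq; have [->|uv] := eqVneq u v; first by rewrite !subrr.
  apply: pq; have := @small_rigid_complete R d W _ _ rig uW vW.
  by apply; rewrite ?card_sig ?(leq_trans V0d).
have [S HS] := rigidity_constants R d (induced_subgraph G V0).
have [x [D [_ _ Dx]]] := dual_family_extend ltr01
  (dual0 ((W * 'I_d) + (U * 'I_d))%type S (fun=> 0)).
pose p w : 'rV[R]_d := \row_j x (inl (w, j)); pose c w : 'rV[R]_d := \row_j x (inr (w, j)).
have Dpc : dual_family S (contracted_coords p c)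
    [set: (W * 'I_d) + (U * 'I_d)]%SET D.
  by case: Dx => DD DS Dx; split=> // i [[w j]|[w j]] iT jT; rewrite /= mxE Dx.
have Dp : dual_family S (fun a => p a.1 0 a.2) [set: W * 'I_d]%SET (fun a => D (inl a)).
  by case: Dpc => DD DS Dpc; split=> // a b _ _; rewrite (Dpc (inl a) (inl b)) ?inE.
have p_rig := rig p (dual_generic Dp).
apply: contrapT => not_linked.
have /choice[pq Hpq] : forall n, exists pq : (V -> 'rV[R]_d) * (V -> 'rV[R]_d),
    [/\ forall w : W, pq.1 (val w) = p w,
        forall z j, `|pq.1 z 0 j - clustered G p c z 0 j| < n.+1%:R^-1,
        forall z t, G z t -> sqd (pq.1 z) (pq.1 t) = sqd (pq.2 z) (pq.2 t),
        pq.2 u = 0 & sqd (pq.1 u) (pq.1 v) <> sqd (pq.2 u) (pq.2 v)].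
  (* The translation by q u keeps the sequence of realizations bounded. *)
  move=> n; have [|p' [p'gen p'p p'c]] := @generic_near_clustered _ _ _ G _ _ p c _ n.+1%:R^-1 _ Dp.
    by rewrite invr_gt0 ltr0n.
  have [q] : exists q, ~ (equivalent G p' q -> enorm (p' u - p' v) = enorm (q u - q v)).
    by apply/existsNP => linked; apply: not_linked; exists p'.
  move=> /not_implyP[p'q p'quv]; exists (p', fun z => q z - q u); rewrite /=.
  have sq z t : sqd (q z - q u) (q t - q u) = sqd (q z) (q t).
    by apply: eq_bigr => j _; rewrite !mxE opprB addrA subrK.
  split=> //; last by rewrite sq => E; apply: p'quv; apply/enormB_eq.
    by move=> z t zt; rewrite sq; apply/enormB_eq; exact: p'q.
  by rewrite subrr.
have [phi [qs [cvg_qs ps_qs]]] := @equivalent_limit R d V G u (clustered G p c)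
  (fun n => (pq n).1) (fun n => (pq n).2) (k_connected_connect Gconn u)
  (fun n => let: And5 _ h _ _ _ := Hpq n in h) (fun n => let: And5 _ _ _ h _ := Hpq n in h)
  (fun n => let: And5 _ _ h _ _ := Hpq n in h).
(* Edges inside a component have length 0 in the limit, so it stays collapsed. *)
have qs_hub (w : U) : qs (val w) = qs (val (fingraph.root (delete_vertices G V0) w)).
  pose a := [pred w' : U | qs (val w) == qs (val w')].
  have a_closed : fingraph.closed (delete_vertices G V0) a.
    apply: intro_closed; first exact: connect_graph_sym.
    move=> y z yz /eqP wy; apply/eqP; rewrite wy; apply/sqd_eq0.
    rewrite -(ps_qs _ _ yz) !clustered_out; apply/sqd_eq0; congr c.
    by apply/(fingraph.rootP (connect_graph_sym _))/connect1.
  have := closed_connect a_closed (connect_root _ w).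
  by rewrite !inE eqxx => /esym/eqP.
have pqs : forall y z : W, sqd (p y) (p z) = sqd (qs (val y)) (qs (val z)).
  apply: (contracted_congruent Gconn V0d _ Dpc grig (q := qs \o val) (c' := qs \o val)).
  - exact: HS p_rig.
  - by move=> y z yz /=; rewrite -(ps_qs _ _ yz) !clustered_in.
  - by move=> w y yw /=; rewrite -qs_hub sqdC -(clustered_out G p) -(clustered_in G p c) ps_qs // sqdC.
have [|b0 [b [b_inj bb0 _ _]]] := @exists_base W [set: W]%SET d.
  by rewrite cardsT card_sig.
have [||n nP] := rigid_limit_congruent p_rig (frame_unitmx b_inj bb0 Dp)
    (q := fun n => (pq (phi n)).2 \o val) _ _ pqs.
- by move=> y j; exact: cvg_qs.
- move=> n y z yz; have [pW _ peq _ _] := Hpq (phi n).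
  by rewrite -!pW /=; exact: peq.
- have [pW _ _ _ neq] := Hpq (phi n); apply: neq.
  by have := nP uW vW; rewrite -!pW /= .
Qed.
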